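(* Let $p$ be a prime, $s\ge1$, and $n=mp^a$ with $m\ge1$, $p\nmid m$, $a\ge0$. The number of Euclidean self-dual cyclic codes of length $n=mp^a$ over ${\rm GR}(p^2,s)$ is \[ \left(N_{\rm E}({\rm GR}(p^2,s),p^a ) \right)^{\delta(m)}\times \prod_{h\in J_1} N_{\rm H}( {\rm GR}(p^2,sm_h),p^a ) \times \prod_{k\in J_2'} N({\rm GR}(p^2,sm_k),p^a ),\] where $\delta(m)=1$ if $m$ is odd and $\delta(m)=2$ if $m$ is even, and the empty product is regarded as $1$.
   Context: ${\rm GR}(p^2,r)$ is the Galois extension of $\mathbb{Z}_{p^2}$ of degree $r$, with Teichmüller set $\mathcal{T}_r=\{0,1,\xi,\dots,\xi^{p^r-2}\}$ ($\xi$ of multiplicative order $p^r-1$); every element is uniquely $a_0+b_0p$ with $a_0,b_0\in\mathcal{T}_r$. For $r$ even, $\overline{a_0+b_0p}=a_0^{p^{r/2}}+b_0^{p^{r/2}}p$ is a ring automorphism. A cyclic code of length $n$ over ${\rm GR}(p^2,r)$ is a submodule of ${\rm GR}(p^2,r)^n$ invariant under the cyclic shift (equivalently, an ideal of ${\rm GR}(p^2,r)[X]/\langle X^n-1\rangle$). It is Euclidean self-dual if it equals its dual with respect to $\sum_i u_iv_i$ and, for $r$ even, Hermitian self-dual if it equals its dual with respect to $\sum_i u_i\overline{v_i}$. $N({\rm GR}(p^2,r),n)$, $N_{\rm E}({\rm GR}(p^2,r),n)$, $N_{\rm H}({\rm GR}(p^2,r),n)$ denote the numbers of cyclic codes, Euclidean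 self-dual cyclic codes, and (for $r$ even) Hermitian self-dual cyclic codes of length $n$ over ${\rm GR}(p^2,r)$. For $0\le h\le m-1$, $S_{p^s}(h)=\{hp^{is}\bmod m\mid i\ge0\}$ is the $p^s$-cyclotomic coset of $h$ modulo $m$ and $m_h=|S_{p^s}(h)|$. It is self-inverse if $S_{p^s}(-h)=S_{p^s}(h)$ (elements taken modulo $m$). $I_0=\{0\}$ if $m$ is odd, $I_0=\{0,m/2\}$ if $m$ is even; $I_1$ is the union of all self-inverse cosets not contained in $I_0$ (for $h\in I_1$, $m_h$ is even); $I_2=\{0,\dots,m-1\}\setminus(I_0\cup I_1)$. $J_1,J_2$ are complete sets of representatives of the $p^s$-cyclotomic cosets in $I_1,I_2$, with $J_2$ chosen so that $h\in J_2$ iff $-h\in J_2$ (modulo $m$). $J_2$ is written as a disjoint union $J_2=J_2'\cup J_2''$ with $J_2''=\{-h\mid h\in J_2'\}$. *)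

(* Defs.v *)
From HB Require Import structures.
From mathcomp Require Import all_boot all_order all_algebra.
From mathcomp Require Import falgebra fieldext separable galois finfield.

Set Implicit Arguments.
Unset Strict Implicit.
Unset Printing Implicit Defensive.

Import GRing.Theory.
Local Open Scope ring_scope.

HB.instance Definition _ (R : finComNzRingType) (h : {poly R}) :=
  Finite.on {poly %/ h}.

Section GaloisRings.

Variables (p r : nat).

Definition red_mod_p (f : {poly 'Z_(p ^ 2)}) : {poly 'F_p} :=
  map_poly (fun x : 'Z_(p ^ 2) => (x : nat)%:R) f.

Definition basic_irreducible (f : {poly 'Z_(p ^ 2)}) : Prop :=
  [/\ f \is monic, size f = r.+1 & irreducible_poly (red_mod_p f)].

(* [R] is a model of GR(p^2, r), i.e., of Z_{p^2}[X]/<f> for a monic          *)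
(* polynomial f of degree r that is irreducible modulo p.                     *)
Definition is_galois_ring (R : finComNzRingType) : Prop :=
  exists f : {poly 'Z_(p ^ 2)}, basic_irreducible f /\
  exists phi : {rmorphism {poly %/ f} -> R}, bijective phi.

Lemma exists_basic_irreducible :
  prime p -> (0 < r)%N -> exists f, basic_irreducible f.
Proof.
move=> p_pr r_gt0.
have p2_gt1 : (1 < p ^ 2)%N by rewrite -(exp1n 2) ltn_exp2r ?prime_gt1.
have [F pcharF cardF] := pPrimePowerField p_pr r_gt0.
pose L : splittingFieldType 'F_p := pPrimeCharType pcharF.
have dimL : \dim {: L} = r.
  by rewrite pprimeChar_dimf cardF pfactorK.
have /and3P[_ sepL _] : galois 1 {: L} by apply: finField_galois; apply: sub1v.
pose x := separable_generator 1 {: L}.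
have deg_x : adjoin_degree 1 x = r.
  rewrite adjoin_degreeE dimv1 divn1 -dimL.
  by rewrite [in RHS](eq_adjoin_separable_generator sepL (sub1v _)).
have /polyOver1P[g g_def] := minPolyOver 1 x.
have sz_g : size g = r.+1.
  by rewrite -deg_x -size_minPoly g_def size_map_poly.
have irr_g : irreducible_poly g.
  split=> [|d d_neq1 d_dvd]; first by rewrite sz_g.
  have := @minPoly_irr _ _ 1 x (map_poly (in_alg L) d) (alg_polyOver _ _).
  rewrite g_def dvdp_map !eqp_map -(rmorph1 (map_poly (in_alg L))) eqp_map.
  move=> /(_ d_dvd)/orP[//|/eqp_size]; rewrite size_poly1 => /eqP.
  by rewrite (negPf d_neq1).
have mon_g : g \is monic.
  by rewrite -(map_monic (in_alg L)) -g_def monic_minPoly.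
pose lift_Fp (c : 'F_p) : 'Z_(p ^ 2) := (c : nat)%:R.
pose f := \poly_(i < r.+1) lift_Fp g`_i.
have g_r : g`_r = 1 by move/monicP: mon_g; rewrite lead_coefE sz_g.
have f_r : f`_r = 1.
  by rewrite coef_poly ltnSn g_r /lift_Fp /= modn_small // Fp_cast ?prime_gt1.
have sz_f : size f = r.+1
  by rewrite size_poly_eq //; move: f_r; rewrite coef_poly ltnSn => ->.
exists f; split=> //; first by rewrite monicE lead_coefE sz_f f_r.
suff -> : red_mod_p f = g by [].
apply/polyP=> i; rewrite coef_map_id0 // coef_poly.
case: ltnP => [_ | le_r_i]; last by rewrite nth_default ?sz_g.
have lt_c_p : ((g`_i)%R < p)%N.
  by rewrite -[X in (_ < X)%N](Fp_cast p_pr) ltn_ord.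
rewrite /lift_Fp /= val_Zp_nat // modn_small ?natr_Zp //.
by rewrite (leq_trans lt_c_p) // -[X in (X <= _)%N]expn1 leq_exp2l ?prime_gt1.
Qed.

Lemma exists_galois_ring :
  prime p -> (0 < r)%N -> exists R : finComNzRingType, is_galois_ring R.
Proof.
move=> p_pr r_gt0; have [f irr_f] := exists_basic_irreducible p_pr r_gt0.
pose fin_qpoly (A : finComNzRingType) (h : {poly A}) : finComNzRingType :=
  {poly %/ h}.
by exists (fin_qpoly 'Z_(p ^ 2) f), f; split=> //; exists idfun; exists id.
Qed.

End GaloisRings.

Section Teichmuller.

Variables (p r : nat) (R : finComNzRingType).

(* The roots of unity of order p^r - 1 in GR(p^2, r) all generate the same    *)
(* group, so the set does not depend on the choice of the generator xi.       *)
Definition teichmuller : {set R} :=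
  [set x | (x == 0) || [exists xi : R, (p ^ r).-1.-primitive_root xi &&
                          [exists i : 'I_(p ^ r).-1, x == xi ^+ i]]].

(* Each x in GR(p^2, r) has a unique decomposition a + b p with a and b in    *)
(* the Teichmuller set, so [pick] does not involve any choice; the default    *)
(* value is irrelevant.                                                       *)
Definition galois_conj (x : R) : R :=
  if [pick ab : R * R | [&& ab.1 \in teichmuller, ab.2 \in teichmuller
                          & x == ab.1 + ab.2 *+ p]] is Some ab
  then ab.1 ^+ (p ^ r./2) + ab.2 ^+ (p ^ r./2) *+ p else x.

End Teichmuller.

Section Codes.

Variables (R : finComNzRingType) (n : nat).
Implicit Type C : {set 'rV[R]_n}.

Definition cyclic_shift (u : 'rV[R]_n) : 'rV[R]_n :=
  \row_i u 0 (ord_pred i).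

Definition submodule C : bool :=
  (0 \in C) &&
  [forall a : R, forall u in C, forall v in C, a *: u + v \in C].

Definition cyclic_code C : bool :=
  submodule C && [forall u in C, cyclic_shift u \in C].

Definition dual_code (sigma : R -> R) C : {set 'rV[R]_n} :=
  [set v : 'rV[R]_n | [forall u in C, \sum_i u 0 i * sigma (v 0 i) == 0]].

Definition num_cyclic : nat := #|[set C | cyclic_code C]|.

Definition num_euclidean : nat :=
  #|[set C | cyclic_code C && (C == dual_code id C)]|.

Definition num_hermitian (p r : nat) : nat :=
  #|[set C | cyclic_code C && (C == dual_code (@galois_conj p r R) C)]|.

End Codes.

Section Cosets.

Variables (q m : nat).

Lemma ltn_mod_ord (h : 'I_m) (k : nat) : (k %% m < m)%N.
Proof. by rewrite ltn_mod (leq_ltn_trans _ (ltn_ord h)). Qed.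

Definition mulq_mod (h : 'I_m) : 'I_m := Ordinal (ltn_mod_ord h (h * q)).

Definition opp_mod (h : 'I_m) : 'I_m := Ordinal (ltn_mod_ord h (m - h)).

Definition cyclotomic_coset (h : 'I_m) : {set 'I_m} :=
  [set k | fconnect mulq_mod h k].

Lemma cyclotomic_cosetP (h k : 'I_m) :
  reflect (exists i, k = h * q ^ i %% m :> nat)%N (k \in cyclotomic_coset h).
Proof.
have iterE i : (iter i mulq_mod h = h * q ^ i %% m :> nat)%N.
  elim: i => [|i IHi]; first by rewrite muln1 modn_small.
  by rewrite iterS /= IHi modnMml expnSr mulnA.
rewrite inE; apply: (iffP idP) => [/iter_findex <- | [i k_def]].
  by exists (findex mulq_mod h k).
by rewrite -[k](_ : iter i mulq_mod h = k) ?fconnect_iter //; apply: val_inj;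
  rewrite /= iterE.
Qed.

Definition self_inverse_coset (h : 'I_m) : bool :=
  cyclotomic_coset (opp_mod h) == cyclotomic_coset h.

Definition I0 : {set 'I_m} :=
  [set h : 'I_m | (h == 0%N :> nat) || ~~ odd m && (h == m./2 :> nat)].

Definition I1 : {set 'I_m} :=
  \bigcup_(h | self_inverse_coset h && ~~ (cyclotomic_coset h \subset I0))
    cyclotomic_coset h.

Definition I2 : {set 'I_m} := ~: (I0 :|: I1).

Definition coset_representatives (J I : {set 'I_m}) : bool :=
  is_transversal J [set cyclotomic_coset h | h in I] I.

End Cosets.

(* Main.v *)
Require Import Defs.
From HB Require Import structures.
From mathcomp Require Import all_boot all_order all_algebra.
From mathcomp Require Import fingroup cyclic finfield qfpoly zify ring.

(** The code of length n = m N, N = p^a, is an ideal of A = R[X]/(X^n - 1), and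
    its Euclidean dual is the preimage of its annihilator under the involution
    tau: X -> X^-1.  Since p does not divide m, an m-th root of unity zeta lives
    in a large Galois ring B, and the maps X -> zeta^h Y, for h running through
    representatives of the cyclotomic cosets, identify A with the product of the
    rings A_h = GR(p^2, s m_h)[Y]/(Y^N - 1); joint injectivity is Fourier inversion
    in B together with the Frobenius of B, and surjectivity is a cardinality count.
    Under this isomorphism tau maps the h-th factor to the (-h)-th one.  For h in
    I0 it is the involution of A_h; for h in I1 it is that involution composed
    with the conjugation of GR(p^2, s m_h), which maps zeta^h to
    zeta^(h q^(m_h/2)) = zeta^(-h); for h in I2 it exchanges two factors, and since
    ideals are equal to their double annihilators, the ideal in the first factor
    is arbitrary and determines the other one. *)

Set Implicit Arguments.
Unset Strict Implicit.
Unset Printing Implicit Defensive.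

Import GRing.Theory.
Local Open Scope ring_scope.

(** * Quotients of polynomial rings *)

(** The rings GR(p^2, r) are given as arbitrary models, with no chosen maps between them. Everything
    about such a ring S is drawn from its reduction onto a finite field, whose kernel is both pS and
    the annihilator of p, together with p^2 = 0; maps between two such rings are lifts of maps into
    residue fields. To keep the factors comparable, one embedding of R into B is fixed and then
    factored through each GR(p^2, s m_h): a map built separately could differ by an automorphism.
    The rings have zero divisors, so Fourier inversion needs m and the zeta^i - 1 (m not dividing i)
    to be units, which is read off in the residue field. The projections onto the A_h are never
    inverted: it suffices that the kernel of each lies in the kernel of X -> zeta^h Y and that the
    sizes match. The equality of an ideal with its double annihilator is a counting result, obtained
    for submodules of R^n and transported to ideals. *)

Lemma horner_addl_sqr0 (R : comNzRingType) (f : {poly R}) (x e : R) :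
  e * e = 0 -> f.[x + e] = f.[x] + f^`().[x] * e.
Proof.
move=> e2; elim/poly_ind: f => [|f c IHf].
  by rewrite deriv0 !horner0 mul0r addr0.
rewrite derivD derivM derivX derivC mulr1 addr0 !hornerE IHf.
have -> : (f.[x] + f^`().[x] * e) * (x + e) =
  (f.[x] + f^`().[x] * e) * x + f.[x] * e + f^`().[x] * (e * e) by ring.
by rewrite e2; ring.
Qed.

Lemma in_qpoly_val (A : nzRingType) (h : {poly A}) (u : {poly %/ h}) :
  in_qpoly h u = u.
Proof. by apply: val_inj; apply: in_qpoly_small (size_mk_monic u). Qed.

Lemma size_qpoly (A : nzRingType) (h : {poly A}) (u : {poly %/ h}) :
  h \is monic -> (1 < size h)%N -> (size u < size h)%N.
Proof.
move=> h_monic h_gt1; have := size_mk_monic u.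
by rewrite [X in (_ < X)%N](_ : _ = size h) // /mk_monic h_gt1 h_monic.
Qed.

(** Division by a monic h does not change the value at a root x of h. Both hypotheses on h matter:
    [{poly %/ h}] is a quotient by X when h is constant or not monic. *)
Lemma qpoly_lift (A S : comNzRingType) (h : {poly A}) (iota : {rmorphism A -> S})
    (x : S) :
  h \is monic -> (1 < size h)%N -> (map_poly iota h).[x] = 0 ->
  exists phi : {rmorphism {poly %/ h} -> S},
    forall f, phi (in_qpoly h f) = (map_poly iota f).[x].
Proof.
move=> h_monic h_gt1 hx0.
pose phi (u : {poly %/ h}) := (map_poly iota (u : {poly A})).[x].
have phiE f : phi (in_qpoly h f) = (map_poly iota f).[x].
  rewrite /phi /= /mk_monic h_gt1 h_monic /=.
  rewrite [in RHS](Pdiv.RingMonic.rdivp_eq h_monic f) rmorphD rmorphM /=.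
  by rewrite hornerD hornerM hx0 mulr0 add0r.
have phiB : zmod_morphism phi by move=> u v; rewrite /phi !raddfB hornerD hornerN.
have phiM : monoid_morphism phi.
  split=> [|u v]; first by rewrite /phi rmorph1 hornerE.
  have -> : u * v = in_qpoly h ((u : {poly A}) * (v : {poly A})) by [].
  by rewrite phiE rmorphM hornerM.
pose phiBI := GRing.isZmodMorphism.Build _ _ phi phiB.
pose phiMI := GRing.isMonoidMorphism.Build _ _ phi phiM.
pose f : {rmorphism {poly %/ h} -> S} := HB.pack phi phiBI phiMI.
by exists f.
Qed.

Lemma rmorph_qpolyE (A S : comNzRingType) (h : {poly A})
    (phi : {rmorphism {poly %/ h} -> S}) f :
  phi (in_qpoly h f) = (map_poly (phi \o qpolyC h) f).[phi (in_qpoly h 'X)].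
Proof.
elim/poly_ind: f => [|f c IHf]; first by rewrite in_qpoly0 !rmorph0 horner0.
rewrite in_qpolyD in_qpolyM !rmorphD !rmorphM /= IHf map_polyX map_polyC !hornerE /=.
by rewrite -[qpolyC h c]in_qpoly_val.
Qed.

Lemma eq_qpoly_rmorph (A S : comNzRingType) (h : {poly A})
    (phi psi : {rmorphism {poly %/ h} -> S}) :
  (forall c, phi (qpolyC h c) = psi (qpolyC h c)) ->
  phi (in_qpoly h 'X) = psi (in_qpoly h 'X) -> phi =1 psi.
Proof.
move=> eqC eqX u; have [f ->] : exists f, u = in_qpoly h f.
  by exists u; rewrite in_qpoly_val.
rewrite (rmorph_qpolyE phi) (rmorph_qpolyE psi) eqX.
by congr horner; apply: eq_map_poly => c; apply: eqC.
Qed.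

Lemma Zp_rmorphism n (S : comNzRingType) :
  (1 < n)%N -> n%:R = 0 :> S ->
  exists phi : {rmorphism 'Z_n -> S}, forall c, phi c = (c : nat)%:R.
Proof.
move=> n_gt1 n0; pose phi (c : 'Z_n) : S := (c : nat)%:R.
have modE k : (k %% n)%:R = k%:R :> S.
  by rewrite [in RHS](divn_eq k n) natrD natrM n0 mulr0 add0r.
have modE' k : (k %% (Zp_trunc n).+2)%:R = k%:R :> S by rewrite Zp_cast ?modE.
have phiD : {morph phi : x y / x + y}.
  by move=> x y; rewrite /phi /= modE' natrD.
have phiB : zmod_morphism phi.
  move=> x y; apply: (addIr (phi y)); rewrite subrK -phiD subrK //.
have phiM : monoid_morphism phi.
  split=> [|x y]; first by rewrite /phi /= modE'.
  by rewrite /phi /= modE' natrM.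
pose phiBI := GRing.isZmodMorphism.Build _ _ phi phiB.
pose phiMI := GRing.isMonoidMorphism.Build _ _ phi phiM.
by exists (HB.pack phi phiBI phiMI : {rmorphism 'Z_n -> S}).
Qed.

(** Every element of ['Z_n] is a multiple of 1. Coefficient maps obtained along different routes
    therefore agree. *)
Lemma eq_Zp_rmorphism n (S : comNzRingType) (phi psi : {rmorphism 'Z_n -> S}) :
  phi =1 psi.
Proof. by move=> c; rewrite -[c]natr_Zp !rmorph_nat. Qed.

(* [rho] is the reduction modulo p of GR(p^2, r); the last two fields say that
   the annihilator of p is pS and that p^2 = 0. *)
Record residue_map (p r : nat) (S : finComNzRingType) (k : finFieldType)
    (rho : {rmorphism S -> k}) : Prop := ResidueMap {
  residue_card : #|k| = (p ^ r)%N;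
  residue_surj : forall a, exists x, rho x = a;
  residue_ker : forall x, rho x = 0 -> exists y, x = y *+ p;
  residue_char : p%:R = 0 :> k;
  residue_tors : forall x, x *+ p = 0 -> rho x = 0;
  residue_sqr : forall x : S, x *+ p *+ p = 0 }.

Lemma galois_ring_card p r (S : finComNzRingType) :
  prime p -> is_galois_ring p r S -> #|S| = (p ^ (2 * r))%N.
Proof.
move=> p_pr [f [[f_monic sz_f [sz_g _]] [phi /bij_eq_card <-]]].
have p2_gt1 : (1 < p ^ 2)%N by rewrite -(exp1n 2) ltn_exp2r ?prime_gt1.
have r_gt0 : (0 < r)%N.
  rewrite -ltnS -sz_f; apply: leq_trans sz_g _.
  exact: size_poly.
rewrite card_monic_qpoly ?sz_f // card_ord Zp_cast //= -expnM //.
Qed.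

Lemma rmorph_bij_inv (A B : nzRingType) (phi : {rmorphism A -> B}) :
  bijective phi -> exists psi : {rmorphism B -> A}, cancel phi psi /\ cancel psi phi.
Proof.
case=> psi phiK psiK.
pose psiB := GRing.isZmodMorphism.Build _ _ psi (can2_zmod_morphism phiK psiK).
pose psiM := GRing.isMonoidMorphism.Build _ _ psi (can2_monoid_morphism phiK psiK).
by exists (HB.pack psi psiB psiM : {rmorphism B -> A}).
Qed.

Lemma residue_map_iso p r (S S' : finComNzRingType) (k : finFieldType)
    (phi : {rmorphism S -> S'}) (rho : {rmorphism S -> k}) :
  bijective phi -> residue_map p r rho ->
  exists rho' : {rmorphism S' -> k}, residue_map p r rho'.
Proof.
case/rmorph_bij_inv=> psi [phiK psiK] [cardk surj ker char tors sqr].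
exists (rho \o psi); split=> //= [a | x /ker[y yE] | x xp | x].
- by have [x <-] := surj a; exists (phi x); rewrite phiK.
- by exists (phi y); rewrite -rmorphMn -yE psiK.
- by apply: tors; rewrite -rmorphMn xp rmorph0.
- by have := congr1 phi (sqr (psi x)); rewrite !rmorphMn psiK rmorph0.
Qed.

(** * The residue field of a Galois ring *)

Section ResidueField.

Variables (p r : nat).
Hypothesis p_pr : prime p.

Let p2_gt1 : (1 < p ^ 2)%N.
Proof. by rewrite -(exp1n 2) ltn_exp2r ?prime_gt1. Qed.

Lemma Fp_dvdn_Zp2 (c : 'Z_(p ^ 2)) :
  (c : nat)%:R = 0 :> 'F_p -> c = ((c : nat) %/ p)%:R *+ p.
Proof.
move/eqP; rewrite -(dvdn_pcharf (pchar_Fp p_pr)) => /divnK cE.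
by rewrite -mulrnA cE natr_Zp.
Qed.

Lemma Zp2_mulrn_eq0 (c : 'Z_(p ^ 2)) : c *+ p = 0 -> (c : nat)%:R = 0 :> 'F_p.
Proof.
rewrite -{1}[c]natr_Zp -mulrnA => /(congr1 val) /=.
rewrite val_Zp_nat // => /eqP; rewrite -[_ == _]/(_ %| _)%N.
move: (c : nat) => {}c; rewrite -mulnn dvdn_pmul2r ?prime_gt0 // => p_c.
by apply/eqP; rewrite -(dvdn_pcharf (pchar_Fp p_pr)).
Qed.

(** The field is F_p[X]/(f mod p) and rho reduces coefficients modulo p. Kernel and p-torsion are
    computed coefficientwise, on representatives of degree less than r. *)
Lemma qpoly_residue (f : {poly 'Z_(p ^ 2)}) :
  basic_irreducible r f ->
  exists (k : finFieldType) (rho : {rmorphism {poly %/ f} -> k}), residue_map p r rho.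
Proof.
move=> [f_monic sz_f g_irr].
have p2_0 : (p ^ 2)%:R = 0 :> 'F_p by rewrite natrX pchar_Fp_0 // expr0n.
have [red redE] := Zp_rmorphism p2_gt1 p2_0.
have gE : red_mod_p f = map_poly red f by apply: eq_map_poly => c; rewrite redE.
set g := map_poly red f in gE; rewrite gE in g_irr.
have g_monic : g \is monic by rewrite monic_map.
have sz_g : size g = r.+1 by rewrite size_map_poly_id0 // (monicP f_monic) rmorph1 oner_eq0.
have r_gt0 : (0 < r)%N by case: g_irr; rewrite sz_g ltnS.
have gI : monic_irreducible_poly g by split.
pose k : finFieldType := {poly %/ g with gI}.
have mkg : mk_monic g = g by rewrite /mk_monic g_monic sz_g ltnS r_gt0.
have mkf : mk_monic f = f by rewrite /mk_monic f_monic sz_f ltnS r_gt0.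
have gX0 (u : {poly 'Z_(p ^ 2)}) :
  (map_poly (qpolyC g \o red) u).[in_qpoly g 'X] = in_qpoly g (map_poly red u).
  by rewrite map_poly_comp -in_qpoly_comp_horner comp_polyXr.
have [|//|rho rhoE] := @qpoly_lift _ k f (qpolyC g \o red) (in_qpoly g 'X) f_monic.
- by rewrite sz_f ltnS.
- by rewrite gX0; apply: val_inj; rewrite /= mkg Pdiv.RingMonic.rmodpp.
have {}rhoE u : rho (in_qpoly f u) = in_qpoly g (map_poly red u) by rewrite rhoE gX0.
have fE (u : {poly %/ f}) : exists2 v : {poly 'Z_(p ^ 2)}, u = in_qpoly f v & (size v <= r)%N.
  by exists u; rewrite ?in_qpoly_val // -ltnS -sz_f size_qpoly ?sz_f.
have szred u : (size (map_poly red u) <= size u)%N by apply: size_poly.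
have in_f (u : {poly 'Z_(p ^ 2)}) : (size u <= r)%N -> in_qpoly f u = u :> {poly _}.
  by move=> sz_u; rewrite in_qpoly_small // mkf sz_f ltnS.
exists k, rho; split=> [|a | x |  | x | x].
- by rewrite card_qfpoly sz_g card_ord Fp_cast.
- have [v aE] : exists v : {poly 'F_p}, v = a :> {poly 'F_p} by exists (a : {poly %/ g}).
  pose u : {poly 'Z_(p ^ 2)} := \poly_(i < r) ((v`_i)%R : nat)%:R.
  exists (in_qpoly f u); rewrite rhoE -[RHS]in_qpoly_val -aE; congr in_qpoly.
  apply/polyP=> i; rewrite coef_map coef_poly; case: ltnP => [_|le_ri].
    by rewrite /= rmorph_nat natr_Zp.
  by rewrite /= rmorph0 nth_default // aE (leq_trans _ le_ri) // -ltnS -sz_g size_qpoly ?sz_g.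
- have [u -> sz_u] := fE x; rewrite rhoE => /(congr1 (fun v : k => v : {poly 'F_p})).
  rewrite in_qpoly_small ?mkg ?sz_g ?ltnS ?(leq_trans (szred u)) // => ru0.
  pose v := \poly_(i < r) ((u`_i)%R %/ p)%:R : {poly 'Z_(p ^ 2)}.
  exists (in_qpoly f v); rewrite -raddfMn; congr in_qpoly.
  apply/polyP=> i; rewrite coefMn coef_poly; case: ltnP => [_|le_ri].
    by apply: Fp_dvdn_Zp2; rewrite -redE -coef_map ru0 coef0.
  by rewrite mul0rn nth_default // (leq_trans sz_u).
- by rewrite -(rmorph_nat (qpolyC g)) pchar_Fp_0 // rmorph0.
- have [u -> sz_u] := fE x; rewrite rhoE -raddfMn /=.
  move=> /(congr1 (fun w : {poly %/ f} => w : {poly 'Z_(p ^ 2)})).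
  rewrite in_f; last first.
    by apply: leq_trans sz_u; apply/leq_sizeP => j le_uj; rewrite coefMn nth_default ?mul0rn.
  move=> up0; suff -> : map_poly red u = 0 by rewrite rmorph0.
  apply/polyP=> i; rewrite coef_map coef0 /= redE; apply: Zp2_mulrn_eq0.
  by rewrite -coefMn up0 coef0.
- rewrite -mulrnA mulnn -mulr_natr -(rmorph_nat (qpolyC f)).
  suff -> : (p ^ 2)%:R = 0 :> 'Z_(p ^ 2) by rewrite rmorph0 mulr0.
  exact: pchar_Zp.
Qed.

End ResidueField.

(** * Lifting morphisms to Galois rings *)

(** In the field F[X]/(g), of cardinality |F|^(deg g), the class of X is fixed by the power |F|^e
    whenever deg g divides e. *)
Lemma irreducible_dvdp_XnsubX (F : finFieldType) (g : {poly F}) e :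
  g \is monic -> irreducible_poly g -> ((size g).-1 %| e)%N ->
  g %| 'X^(#|F| ^ e) - 'X.
Proof.
move=> g_monic g_irr /dvdnP[d ->].
have gI : monic_irreducible_poly g by split.
have sz_g : (1 < size g)%N by case: g_irr.
have cardk := card_qfpoly gI.
have mkg : mk_monic g = g by rewrite /mk_monic g_monic sz_g.
suff : in_qpoly g ('X^(#|F| ^ (d * (size g).-1)) - 'X) = 0.
  move/(congr1 val) => /=; rewrite mkg -Pdiv.IdomainMonic.modpE // => /eqP.
  by rewrite -/(dvdp _ _).
rewrite rmorphB rmorphXn /= mulnC expnM -cardk.
apply/eqP; rewrite subr_eq0; apply/eqP.
pose x : {poly %/ g with gI} := in_qpoly g 'X.
have : x ^+ (#|{poly %/ g with gI}| ^ d) = x.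
  by elim: d => [|d IHd]; rewrite ?expr1 // expnS exprM expf_card.
by [].
Qed.

(** With d = deg g, g divides X^(|F|^d) - X, whose derivative is -1; a common root of g and its
    derivative would be a root of -1. *)
Lemma irreducible_root_simple (F : finFieldType) (K : fieldType)
    (kappa : {rmorphism F -> K}) (g : {poly F}) (a : K) :
  g \is monic -> irreducible_poly g -> root (map_poly kappa g) a ->
  (map_poly kappa g)^`().[a] != 0.
Proof.
move=> g_monic g_irr /rootP ga0; apply/eqP=> g'a0.
have sz_g : (1 < size g)%N by case: g_irr.
have /dvdpP[q qE] := irreducible_dvdp_XnsubX g_monic g_irr (dvdnn _).
have := congr1 (fun f => (map_poly kappa f)^`().[a]) qE.
rewrite /= rmorphM derivM hornerD !hornerM ga0 g'a0 !mulr0 addr0.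
rewrite rmorphB rmorphXn /= map_polyX derivB derivX derivXn hornerD hornerN.
(* Lagrange's theorem in the additive group of F. *)
have F0 : #|F|%:R = 0 :> F.
  by rewrite -cardsT -FinRing.zmodXgE expg_cardG ?inE.
rewrite hornerMn -[X in X - _]mulr_natr.
have -> : (#|F| ^ (size g).-1)%:R = 0 :> K.
  rewrite natrX -(rmorph_nat kappa) F0 rmorph0 expr0n.
  by case: (size g) sz_g => [|[]].
rewrite mulr0 hornerC sub0r => /eqP.
by rewrite oppr_eq0 oner_eq0.
Qed.

(** X^|K| - X is the product of all X - x with x in K, so its divisor g is a nonempty subproduct up
    to a constant. *)
Lemma irreducible_split_root (F K : finFieldType) (kappa : {rmorphism F -> K})
    (g : {poly F}) e :
  g \is monic -> irreducible_poly g -> ((size g).-1 %| e)%N ->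
  #|K| = (#|F| ^ e)%N -> exists a, root (map_poly kappa g) a.
Proof.
move=> g_monic g_irr /(irreducible_dvdp_XnsubX g_monic g_irr) g_dvd cardK.
have : map_poly kappa g %| \prod_(x <- enum K) ('X - x%:P).
  rewrite big_enum /= -finField_genPoly cardK.
  by move: g_dvd; rewrite -(dvdp_map kappa) rmorphB rmorphXn /= map_polyX.
case/dvdp_prod_XsubC=> ms; case: (mask ms _) => [|x s].
  rewrite big_nil => /eqp_size; rewrite size_map_poly size_poly1.
  by case: g_irr => + _ => /[swap] ->.
move=> eqg; exists x; rewrite (eqp_root eqg) root_prod_XsubC mem_head //.
Qed.

Section Lifting.

Variables (p r : nat).
Hypothesis p_pr : prime p.

Let p2_gt1 : (1 < p ^ 2)%N.
Proof. by rewrite -(exp1n 2) ltn_exp2r ?prime_gt1. Qed.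

Let p_dvdr k : (p %| k)%N -> k%:R = 0 :> 'F_p.
Proof. by rewrite (dvdn_pcharf (pchar_Fp p_pr)) => /eqP. Qed.

Lemma galois_ring_residue (S : finComNzRingType) :
  is_galois_ring p r S ->
  exists (k : finFieldType) (rho : {rmorphism S -> k}), residue_map p r rho.
Proof.
move=> [f [f_irr [phi phi_bij]]].
have [k [rho rhoP]] := qpoly_residue p_pr f_irr.
by exists k; apply: residue_map_iso phi_bij rhoP.
Qed.

Lemma galois_ring_gt0 (S : finComNzRingType) : is_galois_ring p r S -> (0 < r)%N.
Proof.
move=> [f [[_ sz_f [sz_g _]] _]]; rewrite -ltnS -sz_f.
by apply: leq_trans sz_g _; apply: size_poly.
Qed.

Lemma Fp_rmorphism (K : comNzRingType) : p%:R = 0 :> K ->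
  inhabited {rmorphism 'F_p -> K}.
Proof.
move=> p0; have pd : pdiv p = p by apply: pdiv_id.
have [||kappa _] := @Zp_rmorphism (pdiv p) K; [by rewrite pd prime_gt1|by rewrite pd|].
exact: (inhabits kappa).
Qed.

(** If xy = 1 + zp, then 1 - zp is the inverse of 1 + zp because p^2 = 0. *)
Lemma residue_unit t (S : finComNzRingType) (k : finFieldType)
    (rho : {rmorphism S -> k}) x :
  residue_map p t rho -> rho x != 0 -> exists y, x * y = 1.
Proof.
move=> rhoP x0; have [y yE] := residue_surj rhoP (rho x)^-1.
have /(residue_ker rhoP)[z zE] : rho (x * y - 1) = 0.
  by rewrite rmorphB rmorphM rmorph1 yE divff // subrr.
exists (y * (1 - z *+ p)).
have -> : x * (y * (1 - z *+ p)) = (x * y - 1) * (1 - z *+ p) + (1 - z *+ p) by ring.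
rewrite zE mulrBr mulr1 mulrnAr mulrnAl (residue_sqr rhoP) subr0.
by rewrite addrC subrK.
Qed.

(* Hensel lifting: as p^2 = 0, one Newton step turns an approximate root into an
   exact one. *)
Lemma residue_lift t (S S' : finComNzRingType) (k' : finFieldType)
    (rho' : {rmorphism S' -> k'}) (psi : {rmorphism S -> k'}) :
  is_galois_ring p r S -> residue_map p t rho' ->
  exists phi : {rmorphism S -> S'}, forall x, rho' (phi x) = psi x.
Proof.
move=> Sgr rho'P; have r_gt0 := galois_ring_gt0 Sgr.
case: Sgr => f [[f_monic sz_f g_irr] [theta /rmorph_bij_inv[eta [thetaK etaK]]]].
have [red redE] := Zp_rmorphism p2_gt1 (p_dvdr (dvdn_exp (isT : 0 < 2)%N (dvdnn p))).
have gE : red_mod_p f = map_poly red f by apply: eq_map_poly => c; rewrite redE.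
set g := map_poly red f in gE; rewrite gE in g_irr.
have g_monic : g \is monic by rewrite monic_map.
have p2_S' : (p ^ 2)%:R = 0 :> S' by rewrite -mulnn natrM mulr_natr (residue_sqr rho'P).
have [iota _] := Zp_rmorphism p2_gt1 p2_S'.
have [kappa] := Fp_rmorphism (residue_char rho'P).
pose a := psi (theta (in_qpoly f 'X)).
(* Reduction commutes with evaluation: both coefficient maps from ['Z_(p ^ 2)] to [k'] are the
   unique one. *)
have mapE (u : {poly 'Z_(p ^ 2)}) x : rho' (map_poly iota u).[x] =
    (map_poly kappa (map_poly red u)).[rho' x].
  rewrite -horner_map -!map_poly_comp; congr horner; apply: eq_map_poly => c.
  exact: (eq_Zp_rmorphism (rho' \o iota) (kappa \o red)).
have psiE u : psi (theta (in_qpoly f u)) = (map_poly kappa (map_poly red u)).[a].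
  rewrite -[LHS]/((psi \o theta) (in_qpoly f u)) rmorph_qpolyE -map_poly_comp.
  congr horner; apply: eq_map_poly => c.
  exact: (eq_Zp_rmorphism (psi \o theta \o qpolyC f) (kappa \o red)).
have ga0 : root (map_poly kappa g) a.
  apply/rootP; rewrite -psiE.
  suff -> : in_qpoly f f = 0 by rewrite !rmorph0.
  apply: val_inj; rewrite /= /mk_monic f_monic sz_f ltnS r_gt0.
  exact: Pdiv.RingMonic.rmodpp.
have g'a := irreducible_root_simple g_monic g_irr ga0.
have [x0 x0E] := residue_surj rho'P a.
set F := map_poly iota f.
have [w wE] : exists w, F^`().[x0] * w = 1.
  apply: residue_unit rho'P _.
  by rewrite /F deriv_map mapE -!deriv_map x0E.
have [c cE] : exists c, F.[x0] = c *+ p.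
  by apply: (residue_ker rho'P); rewrite mapE x0E; apply/rootP.
(* Here w inverts F'(x0), a unit because a is a simple root of g. *)
pose x := x0 - F.[x0] * w.
have Fx0 : F.[x] = 0.
  rewrite /x horner_addl_sqr0.
    by rewrite mulrN [F.[x0] * w]mulrC mulrA wE mul1r subrr.
  by rewrite cE mulrNN mulrACA [c *+ p * _]mulrnAr mulrnAl (residue_sqr rho'P) mul0r.
have rhox : rho' x = a.
  by rewrite rmorphB rmorphM mapE x0E (rootP ga0) mul0r subr0.
have [|phi phiE] := qpoly_lift f_monic _ Fx0; first by rewrite sz_f ltnS.
exists (phi \o eta) => y /=.
by rewrite -[in RHS](etaK y) -[eta y]in_qpoly_val phiE mapE rhox psiE.
Qed.

(** The reduced defining polynomial has degree r dividing t, hence a root in [k'], and X is sent to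
    it. Lifting this map embeds one Galois ring in another. *)
Lemma residue_embedding t (S : finComNzRingType) (k' : finFieldType) :
  is_galois_ring p r S -> (r %| t)%N -> #|k'| = (p ^ t)%N ->
  p%:R = 0 :> k' -> inhabited {rmorphism S -> k'}.
Proof.
move=> Sgr r_t cardk' pk'; have r_gt0 := galois_ring_gt0 Sgr.
case: Sgr => f [[f_monic sz_f g_irr] [theta /rmorph_bij_inv[eta _]]].
have [red redE] := Zp_rmorphism p2_gt1 (p_dvdr (dvdn_exp (isT : 0 < 2)%N (dvdnn p))).
have gE : red_mod_p f = map_poly red f by apply: eq_map_poly => c; rewrite redE.
set g := map_poly red f in gE; rewrite gE in g_irr.
have g_monic : g \is monic by rewrite monic_map.
have sz_g : size g = r.+1 by rewrite size_map_poly_id0 // (monicP f_monic) rmorph1 oner_eq0.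
have [kappa] := Fp_rmorphism pk'.
have [||a /rootP ga0] := irreducible_split_root kappa g_monic g_irr (e := t).
- by rewrite sz_g.
- by rewrite card_Fp.
have [||phi _] := @qpoly_lift _ _ f (kappa \o red) a f_monic.
- by rewrite sz_f ltnS.
- by rewrite map_poly_comp.
exact: (inhabits (phi \o eta : {rmorphism S -> k'})).
Qed.

End Lifting.

(** * Teichmuller representatives and Frobenius *)

Section TeichmullerTheory.

Variables (p r : nat) (S : finComNzRingType) (k : finFieldType).
Variable rho : {rmorphism S -> k}.
Hypotheses (p_pr : prime p) (r_gt0 : (0 < r)%N) (rhoP : residue_map p r rho).

Local Notation Q := (p ^ r)%N.

Let Q_gt1 : (1 < Q)%N.
Proof. by rewrite -(exp1n r) ltn_exp2r ?prime_gt1. Qed.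

Lemma residue_eqP x y : rho x = rho y -> exists z, x = y + z *+ p.
Proof.
move=> /eqP; rewrite -subr_eq0 -rmorphB => /eqP/(residue_ker rhoP)[z zE].
by exists z; rewrite -zE addrC subrK.
Qed.

(** If x = y + pz, then x^p = y^p + p y^(p-1) pz = y^p, since p^2 = 0. *)
Lemma residue_eq_expr x y j : (0 < j)%N -> rho x = rho y -> x ^+ (p ^ j) = y ^+ (p ^ j).
Proof.
case: j => // j _; rewrite expnS !exprM => /residue_eqP[z ->]; congr (_ ^+ _).
have := @horner_addl_sqr0 S 'X^p y (z *+ p).
rewrite derivXn !hornerE => ->; last first.
  by rewrite mulrnAr mulrnAl (residue_sqr rhoP).
by rewrite hornerMn mulrnAl -mulrnAr (residue_sqr rhoP) mulr0 addr0.
Qed.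

(** Teichmuller elements are handled as the solutions of x^Q = x; each is its own Q-th power, and
    Q-th powers depend only on residues. *)
Lemma teich_inj (x y : S) : x ^+ Q = x -> y ^+ Q = y -> rho x = rho y -> x = y.
Proof. by move=> {2}<- {2}<-; apply: residue_eq_expr. Qed.

Lemma residue_expQ (x : S) : rho (x ^+ Q) = rho x.
Proof. by rewrite rmorphXn -(residue_card rhoP) expf_card. Qed.

Lemma teich_expQ (x : S) : (x ^+ Q) ^+ Q = x ^+ Q.
Proof. by apply: residue_eq_expr => //; apply: residue_expQ. Qed.

(** x^Q is a Teichmuller element with the residue of x, so x = x^Q + cp; in cp only the residue of c
    counts, and c may be replaced by c^Q. *)
Lemma teich_decomposition (x : S) :
  exists a b, [/\ a ^+ Q = a, b ^+ Q = b & x = a + b *+ p].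
Proof.
have /esym/residue_eqP[c cE] := residue_expQ x.
have /esym/residue_eqP[d dE] := residue_expQ c.
exists (x ^+ Q), (c ^+ Q); split; rewrite ?teich_expQ //.
by rewrite cE {1}dE mulrnDl (residue_sqr rhoP) addr0 -cE.
Qed.

(** The generator is the Q-th power of a lift of a generator of the multiplicative group of k. It is
    a unit with xi^Q = xi, so its order divides Q - 1, and its residue already has order Q - 1. *)
Lemma teich_generator :
  exists xi : S, [/\ xi ^+ Q = xi, Q.-1.-primitive_root xi & Q.-1.-primitive_root (rho xi)].
Proof.
have Q1_gt0 : (0 < Q.-1)%N by rewrite -ltnS prednK // ltnW.
have QE : Q = Q.-1.+1 by rewrite prednK // ltnW.
have /hasP[w _ w_prim] : has Q.-1.-primitive_root (enum (fun x : k => x != 0)).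
  apply: has_prim_root; rewrite ?enum_uniq //.
    apply/allP=> x; rewrite mem_enum unity_rootE => x_neq0.
    rewrite -(inj_eq (mulfI x_neq0)) -exprS -QE -(residue_card rhoP).
    by rewrite expf_card mulr1.
  by rewrite -cardE -(residue_card rhoP) (cardC1 0).
have [y yE] := residue_surj rhoP w.
have rho_xi : rho (y ^+ Q) = w by rewrite residue_expQ.
exists (y ^+ Q); rewrite rho_xi; split=> //; first exact: teich_expQ.
have xi1 : (y ^+ Q) ^+ Q.-1 = 1.
  have [|z yz] := residue_unit (x := y ^+ Q) rhoP.
    by rewrite rho_xi (prim_root_eq0 w_prim) -lt0n.
  by rewrite -[LHS]mulr1 -yz mulrA -exprSr -QE teich_expQ.
have [m m_prim m_dvd] := prim_order_exists Q1_gt0 xi1.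
suff /eqP <- : m == Q.-1 by [].
rewrite eqn_dvd m_dvd (prim_order_dvd w_prim) -rho_xi -rmorphXn.
by rewrite (prim_expr_order m_prim) rmorph1 eqxx.
Qed.

(** A nonzero solution of x^Q = x has a nonzero residue, which is a power of the residue of the
    generator; equality of residues lifts to equality of Teichmuller elements. *)
Lemma mem_teichmuller (x : S) : (x \in teichmuller p r S) = (x ^+ Q == x).
Proof.
have QE : Q = Q.-1.+1 by rewrite prednK // ltnW.
rewrite inE; apply/orP/eqP => [[/eqP -> | /existsP[xi /andP[xi_prim /existsP[i /eqP ->]]]] | xQ].
- by rewrite expr0n; case: Q Q_gt1.
- have xiQ : xi ^+ Q = xi by rewrite QE exprS (prim_expr_order xi_prim) mulr1.
  by rewrite exprAC xiQ.
have [x0|x_neq0] := eqVneq (rho x) 0.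
  by left; apply/eqP/teich_inj; rewrite ?x0 ?rmorph0 // expr0n; case: Q Q_gt1.
have [xi [xiQ xi_prim rxi_prim]] := teich_generator.
right; apply/existsP; exists xi; rewrite xi_prim; apply/existsP.
have [|i xE] := prim_rootP rxi_prim (_ : rho x ^+ Q.-1 = 1).
  by apply: (mulfI x_neq0); rewrite -exprS -QE -(residue_card rhoP) expf_card mulr1.
exists i; apply/eqP/teich_inj => //; last by rewrite rmorphXn.
by rewrite exprAC xiQ.
Qed.

End TeichmullerTheory.

Lemma finField_frobenius p (k : finFieldType) j :
  p \in [pchar k] -> exists F : {rmorphism k -> k}, forall x, F x = x ^+ (p ^ j).
Proof.
move=> pcharp; elim: j => [|j [F FE]]; first by exists idfun => x; rewrite expr1.
exists (pFrobenius_aut pcharp \o F) => x /=.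
by rewrite FE pFrobenius_autE -exprM expnSr.
Qed.

(** Injectivity of [eps] forces the preimages, so the morphism laws can be checked in B. This yields
    the maps from GR(p^2, s) to GR(p^2, s m_h) that are compatible with the embeddings into the
    large ring. *)
Lemma rmorph_factor (A B : comNzRingType) (C : finComNzRingType)
    (eps : {rmorphism C -> B}) (iota : {rmorphism A -> B}) :
  injective eps -> (forall a, exists c, eps c = iota a) ->
  exists phi : {rmorphism A -> C}, forall a, eps (phi a) = iota a.
Proof.
move=> eps_inj lift.
have lift' a : exists c, eps c == iota a by have [c cE] := lift a; exists c; apply/eqP.
pose phi a := xchoose (lift' a).
have phiE a : eps (phi a) = iota a by apply/eqP/(xchooseP (lift' a)).
have phiB : zmod_morphism phi.
  by move=> a b; apply: eps_inj; rewrite rmorphB !phiE rmorphB.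
have phiM : monoid_morphism phi.
  by split=> [|a b]; apply: eps_inj; rewrite ?rmorphM !phiE ?rmorphM ?rmorph1.
pose phiBI := GRing.isZmodMorphism.Build _ _ phi phiB.
pose phiMI := GRing.isMonoidMorphism.Build _ _ phi phiM.
by exists (HB.pack phi phiBI phiMI : {rmorphism A -> C}).
Qed.

(** * Frobenius maps, embeddings and roots of unity *)

Section GaloisRingTheory.

Variables (p : nat).
Hypothesis p_pr : prime p.

Lemma galois_ring_decomposition r (S : finComNzRingType) (x : S) :
  is_galois_ring p r S ->
  exists a b, [/\ a ^+ (p ^ r) = a, b ^+ (p ^ r) = b & x = a + b *+ p].
Proof.
move=> Sgr; have r_gt0 := galois_ring_gt0 Sgr.
by have [k [rho rhoP]] := galois_ring_residue p_pr Sgr; apply: teich_decomposition rhoP x.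
Qed.

(** The morphism lifts rho followed by a power of the Frobenius of k. On a Teichmuller element t,
    sigma t and t^(p^j) are both Teichmuller and have the same residue. *)
Lemma galois_ring_frobenius r (S : finComNzRingType) j :
  is_galois_ring p r S ->
  exists sigma : {rmorphism S -> S},
    forall t, t ^+ (p ^ r) = t -> sigma t = t ^+ (p ^ j).
Proof.
move=> Sgr; have r_gt0 := galois_ring_gt0 Sgr.
have [k [rho rhoP]] := galois_ring_residue p_pr Sgr.
have pchark : p \in [pchar k] by rewrite inE p_pr (residue_char rhoP) eqxx.
have [F FE] := finField_frobenius j pchark.
have [sigma sigmaE] := residue_lift p_pr (F \o rho) Sgr rhoP.
exists sigma => t tQ; apply: (teich_inj r_gt0 rhoP); last first.
- by rewrite sigmaE /= FE rmorphXn.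
- by rewrite exprAC tQ.
- by rewrite -rmorphXn tQ.
Qed.

(** Whichever Teichmuller decomposition [pick] returns, the formula evaluates sigma on it, and a
    decomposition exists, so the default branch never occurs. *)
Lemma galois_conjE r (S : finComNzRingType) (sigma : {rmorphism S -> S}) :
  is_galois_ring p r S ->
  (forall t, t ^+ (p ^ r) = t -> sigma t = t ^+ (p ^ r./2)) ->
  @galois_conj p r S =1 sigma.
Proof.
move=> Sgr sigmaE x; have r_gt0 := galois_ring_gt0 Sgr.
have [k [rho rhoP]] := galois_ring_residue p_pr Sgr.
rewrite /galois_conj; case: pickP => [[a b] | no_ab] /=.
  rewrite !(mem_teichmuller p_pr r_gt0 rhoP).
  case/and3P=> /eqP aQ /eqP bQ /eqP ->.
  by rewrite rmorphD rmorphMn !sigmaE.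
have [a [b [aQ bQ xE]]] := galois_ring_decomposition x Sgr.
have := no_ab (a, b); rewrite /= !(mem_teichmuller p_pr r_gt0 rhoP).
by rewrite aQ bQ xE !eqxx.
Qed.

(** The last two clauses bound the image from below, which is what factoring other maps through S
    requires. *)
Lemma galois_ring_embedding r t (S S' : finComNzRingType) :
  is_galois_ring p r S -> is_galois_ring p t S' -> (r %| t)%N ->
  exists eps : {rmorphism S -> S'},
    [/\ injective eps,
        forall a, a ^+ (p ^ r) = a -> exists x, eps x = a &
        forall a b, a ^+ (p ^ r) = a -> b ^+ (p ^ r) = b -> exists x, eps x = a + b *+ p].
Proof.
move=> Sgr S'gr r_t; have r_gt0 := galois_ring_gt0 Sgr; have t_gt0 := galois_ring_gt0 S'gr.
have [k [rho rhoP]] := galois_ring_residue p_pr Sgr.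
have [k' [rho' rho'P]] := galois_ring_residue p_pr S'gr.
have [psi] := residue_embedding p_pr Sgr r_t (residue_card rho'P) (residue_char rho'P).
have [eps epsE] := residue_lift p_pr psi Sgr rho'P.
(* A unit of S has a unit as image, and the residue of a unit is nonzero. *)
have rho_ker x : rho' (eps x) = 0 -> rho x = 0.
  move=> ex0; apply/eqP; apply: contraT => /(residue_unit rhoP)[y xy1].
  have := congr1 (rho' \o eps) xy1; rewrite /= !rmorphM !rmorph1 ex0 mul0r.
  by move/esym/eqP; rewrite oner_eq0.
have eps_inj : injective eps.
  apply: raddf_inj => x ex0.
  have /(residue_ker rhoP)[y xE] : rho x = 0 by apply: rho_ker; rewrite ex0 rmorph0.
  (* For x = py in the kernel, eps y is killed by p; hence y is again a multiple of p and x = 0. *)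
  have /(residue_ker rhoP)[z yE] : rho y = 0.
    by apply/rho_ker/(residue_tors rho'P); rewrite -rmorphMn -xE.
  by rewrite xE yE (residue_sqr rhoP).
have Q_gt1 : (1 < p ^ r)%N by rewrite -(exp1n r) ltn_exp2r ?prime_gt1.
have QE : (p ^ r = (p ^ r).-1.+1)%N by rewrite prednK // ltnW.
have teich_up (a : S') : a ^+ (p ^ r) = a -> a ^+ (p ^ t) = a.
  case/dvdnP: r_t => d -> aQ; rewrite mulnC expnM.
  by elim: d => [|d IHd]; rewrite ?expr1 // expnS exprM aQ.
have teich_eps a : a ^+ (p ^ r) = a -> exists x, eps x = a.
  move=> aQ; have [a0|a_neq0] := eqVneq (rho' a) 0.
    exists 0; rewrite rmorph0; apply: (teich_inj t_gt0 rho'P).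
    - by rewrite expr0n expn_eq0 -!leqn0 leqNgt prime_gt0.
    - exact: teich_up.
    - by rewrite a0 rmorph0.
  have [xi [xiQ xi_prim rxi_prim]] := teich_generator p_pr r_gt0 rhoP.
  have xi1 := prim_expr_order xi_prim.
  have w1 : rho' (eps xi) ^+ (p ^ r).-1 = 1 by rewrite -!rmorphXn xi1 !rmorph1.
  have Q1_gt0 : (0 < (p ^ r).-1)%N by rewrite -ltnS -QE.
  (* The residue of eps xi has exact order p^r - 1, so its powers exhaust the roots of unity of that
     exponent in [k'], among them the residue of a. *)
  have [m m_prim m_dvd] := prim_order_exists Q1_gt0 w1.
  have mE : m = (p ^ r).-1.
    apply/eqP; rewrite eqn_dvd m_dvd (prim_order_dvd rxi_prim).
    rewrite -subr_eq0 -rmorphXn -(rmorph1 rho) -rmorphB; apply/eqP/rho_ker.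
    by rewrite !rmorphB !rmorphXn (prim_expr_order m_prim) !rmorph1 subrr.
  rewrite mE in m_prim.
  have [|i aE] := prim_rootP m_prim (_ : rho' a ^+ (p ^ r).-1 = 1).
    by apply: (mulfI a_neq0); rewrite -exprS -QE -rmorphXn aQ mulr1.
  exists (xi ^+ i); apply: (teich_inj t_gt0 rho'P).
  - by apply: teich_up; rewrite -rmorphXn exprAC xiQ.
  - exact: teich_up.
  - by rewrite !rmorphXn.
exists eps; split=> // a b /teich_eps[x <-] /teich_eps[y <-].
by exists (x + y *+ p); rewrite rmorphD rmorphMn.
Qed.

(** A power of the Teichmuller generator whose residue also has order m: so zeta^i - 1 has nonzero
    residue for m not dividing i, and m is nonzero in a field containing a primitive m-th root of
    unity. *)
Lemma galois_ring_root t m (S : finComNzRingType) :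
  is_galois_ring p t S -> (m %| (p ^ t).-1)%N ->
  exists zeta : S, [/\ zeta ^+ m = 1, zeta ^+ (p ^ t) = zeta,
    forall i, ~~ (m %| i)%N -> exists y, (zeta ^+ i - 1) * y = 1 &
    exists y, m%:R * y = 1 :> S].
Proof.
move=> Sgr m_dvd; have t_gt0 := galois_ring_gt0 Sgr.
have [k [rho rhoP]] := galois_ring_residue p_pr Sgr.
have [xi [xiQ xi_prim rxi_prim]] := teich_generator p_pr t_gt0 rhoP.
have z_prim := dvdn_prim_root rxi_prim m_dvd.
exists (xi ^+ ((p ^ t).-1 %/ m)); split=> [||i m_i|].
- by rewrite -exprM divnK // (prim_expr_order xi_prim).
- by rewrite exprAC xiQ.
- apply: (residue_unit rhoP); rewrite rmorphB !rmorphXn rmorph1 subr_eq0.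
  by rewrite -(prim_order_dvd z_prim).
apply: (residue_unit rhoP); rewrite rmorph_nat.
exact: prim_root_natf_neq0 z_prim.
Qed.

End GaloisRingTheory.

(** * Self-dual ideals *)

Section Ideals.

Variable A : finComNzRingType.
Implicit Type I : {set A}.

Definition ideal_set I : bool :=
  (0 \in I) && [forall a, forall x in I, forall y in I, a * x + y \in I].

Definition orthogonal_ideal (tau : A -> A) I : {set A} :=
  [set v | [forall u in I, u * tau v == 0]].

Definition num_ideals : nat := #|[set I | ideal_set I]|.

Definition num_self_dual (tau : A -> A) : nat :=
  #|[set I | ideal_set I && (I == orthogonal_ideal tau I)]|.

Lemma ideal_setP I :
  reflect (0 \in I /\ forall a x y, x \in I -> y \in I -> a * x + y \in I)
    (ideal_set I).
Proof.
apply: (iffP andP) => [[I0 /forallP IP]|[I0 IP]]; split=> //.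
  by move=> a x y xI yI; have /forall_inP/(_ x xI)/forall_inP/(_ y yI) := IP a.
by apply/forallP=> a; apply/forall_inP=> x xI; apply/forall_inP=> y yI; apply: IP.
Qed.

Lemma ideal_setM I a x : ideal_set I -> x \in I -> a * x \in I.
Proof. by case/ideal_setP=> I0 IP xI; rewrite -[a * x]addr0; apply: IP. Qed.

Lemma ideal_setD I x y : ideal_set I -> x \in I -> y \in I -> x + y \in I.
Proof. by case/ideal_setP=> _ IP xI yI; rewrite -[x]mul1r; apply: IP. Qed.

Lemma ideal_set_sum I (K : finType) (F : K -> A) :
  ideal_set I -> (forall k, F k \in I) -> \sum_k F k \in I.
Proof.
move=> idI FI; elim/big_ind: _ => // [|x y]; last exact: ideal_setD.
by case/ideal_setP: idI.
Qed.

Lemma orthogonal_idealP tau I v :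
  reflect (forall u, u \in I -> u * tau v = 0) (v \in orthogonal_ideal tau I).
Proof. by rewrite inE; apply: (iffP forall_inP) => h u /h => [/eqP|->]. Qed.

End Ideals.

(** Stated for additive and multiplicative functions, to cover the exchange of two factors, which is
    kept as a plain function. *)
Lemma orthogonal_ideal_set (A : finComNzRingType) (tau : A -> A) I :
  {morph tau : x y / x + y} -> {morph tau : x y / x * y} ->
  ideal_set (orthogonal_ideal tau I).
Proof.
move=> tauD tauM; apply/ideal_setP; split=> [|a x y /orthogonal_idealP xI /orthogonal_idealP yI].
  apply/orthogonal_idealP=> u _.
  by rewrite (_ : tau 0 = 0) ?mulr0 //; apply: (addrI (tau 0)); rewrite -tauD !addr0.
apply/orthogonal_idealP=> u uI.
by rewrite tauD tauM mulrDr mulrCA xI // yI // mulr0 addr0.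
Qed.

Lemma orthogonal_ideal_rmorph (A : finComNzRingType) (tau : {rmorphism A -> A}) I :
  ideal_set (orthogonal_ideal tau I).
Proof. by apply: orthogonal_ideal_set; [apply: rmorphD | apply: rmorphM]. Qed.

(** * Self-dual ideals of a product of rings *)

Section Product.

Variables (K : finType) (A : finComNzRingType) (B : K -> finComNzRingType).
Variable pi : forall k, {rmorphism A -> B k}.
Hypothesis pi_inj : forall x, (forall k, pi k x = 0) -> x = 0.

Lemma joint_surj :
  (\prod_k #|B k| <= #|A|)%N ->
  forall y : (forall k, B k), exists x, forall k, pi k x = y k.
Proof.
move=> leBA y; pose f x : {dffun forall k, B k} := [ffun k => pi k x].
have f_inj : injective f.
  move=> x x' /ffunP eqf; apply/eqP; rewrite -subr_eq0; apply/eqP/pi_inj => k.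
  by have := eqf k; rewrite !ffunE rmorphB => ->; rewrite subrr.
have leq : (#|{dffun forall k, B k}| <= #|A|)%N.
  by rewrite card_dep_ffun foldrE big_map big_enum /=.
pose fy : {dffun forall k, B k} := [ffun k => y k].
have /imsetP[x _ fx] : fy \in f @: [set: A].
  have /setP/(_ fy) : f @: [set: A] = [set: {dffun forall k, B k}].
    by apply/eqP; rewrite eqEcard subsetT card_imset // !cardsT.
  by rewrite [in RHS]in_setT.
by exists x => k; have /ffunP/(_ k) := fx; rewrite !ffunE.
Qed.

Hypothesis pi_surj : forall y : (forall k, B k), exists x, forall k, pi k x = y k.

Let pi_at k (b : B k) : exists x, pi k x = b.
Proof. by have [x xE] := pi_surj (dfwith (fun j => 0) b); exists x; rewrite xE dfwith_in. Qed.

Let component (I : {set A}) : {dffun forall k, {set B k}} := [ffun k => pi k @: I].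
Let glue (J : forall k, {set B k}) : {set A} := [set x | [forall k, pi k x \in J k]].

Let glueP (J : forall k, {set B k}) x : reflect (forall k, pi k x \in J k) (x \in glue J).
Proof. by rewrite inE; apply: forallP. Qed.

Let glue_component I : ideal_set I -> glue (component I) = I.
Proof.
move=> idI; apply/setP=> x; apply/glueP/idP => [xI|xI k]; last first.
  by rewrite ffunE imset_f.
have y_ex k : exists y, (y \in I) && (pi k y == pi k x).
  by have := xI k; rewrite ffunE => /imsetP[y yI ->]; exists y; rewrite yI eqxx.
(* Preimages of the idempotents of the product: x is the sum of the e_k y_k, where y_k in I has the
   same k-th component as x. *)
have e_ex k : exists x, forall j, pi j x = (j == k)%:R.
  exact: (pi_surj (fun j => (j == k)%:R)).
have [e eE] := fin_all_exists e_ex.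
suff -> : x = \sum_k e k * xchoose (y_ex k).
  apply: ideal_set_sum => // k; apply: ideal_setM => //.
  by case/andP: (xchooseP (y_ex k)).
apply/eqP; rewrite -subr_eq0; apply/eqP/pi_inj => j.
rewrite rmorphB rmorph_sum (bigD1 j) //= big1 => [|k neq_kj].
  rewrite rmorphM eE eqxx mul1r addr0.
  by case/andP: (xchooseP (y_ex j)) => _ /eqP->; rewrite subrr.
by rewrite rmorphM eE eq_sym (negPf neq_kj) mul0r.
Qed.

Let component_glue (J : {dffun forall k, {set B k}}) :
  (forall k, ideal_set (J k)) -> component (glue J) = J.
Proof.
move=> idJ; apply/ffunP=> k; rewrite ffunE; apply/setP=> b.
apply/imsetP/idP => [[z /glueP zJ ->]|bJ]; first exact: zJ.
have [x xE] := pi_surj (dfwith (fun j => 0) b).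
exists x; last by rewrite xE dfwith_in.
apply/glueP=> j; rewrite xE; case: dfwithP => // i neq_ik.
by case/ideal_setP: (idJ i).
Qed.

Let glue_ideal (J : forall k, {set B k}) : (forall k, ideal_set (J k)) -> ideal_set (glue J).
Proof.
move=> idJ; apply/ideal_setP; split=> [|a x y /glueP xJ /glueP yJ].
  by apply/glueP=> k; rewrite rmorph0; case/ideal_setP: (idJ k).
by apply/glueP=> k; rewrite rmorphD rmorphM; case/ideal_setP: (idJ k) => _;
  apply; [apply: xJ | apply: yJ].
Qed.

Let component_ideal I k : ideal_set I -> ideal_set (component I k).
Proof.
case/ideal_setP=> I0 IP; rewrite ffunE; apply/ideal_setP; split.
  by apply/imsetP; exists 0; rewrite ?rmorph0.
move=> b _ _ /imsetP[x xI ->] /imsetP[y yI ->].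
have [a <-] := pi_at b; rewrite -rmorphM -rmorphD imset_f //; exact: IP.
Qed.

Variables (tau : A -> A) (tauB : forall k, B k -> B k).
Hypothesis pi_tau : forall k x, pi k (tau x) = tauB (pi k x).

Let orthogonal_glue I :
  orthogonal_ideal tau I = glue (fun k => orthogonal_ideal (@tauB k) (component I k)).
Proof.
apply/setP=> v; apply/orthogonal_idealP/glueP => [vI k | vI u uI].
  apply/orthogonal_idealP=> w; rewrite ffunE => /imsetP[u uI ->].
  by rewrite -pi_tau -rmorphM vI // rmorph0.
apply: pi_inj => k; rewrite rmorphM pi_tau.
by have /orthogonal_idealP := vI k; apply; rewrite ffunE imset_f.
Qed.

Hypothesis orthB_ideal :
  forall k (I : {set B k}), ideal_set (orthogonal_ideal (@tauB k) I).

(** [component] and [glue] match ideals with families of ideals, and orthogonality is tested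
    componentwise by joint injectivity. *)
Lemma num_self_dual_prod :
  num_self_dual tau = (\prod_k num_self_dual (@tauB k))%N.
Proof.
pose F k : pred {set B k} := fun I => ideal_set I && (I == orthogonal_ideal (@tauB k) I).
have -> : (\prod_k num_self_dual (@tauB k) =
    #|(family F : simpl_pred {dffun forall k, {set B k}})|)%N.
  rewrite card_family foldrE big_map big_enum /=.
  by apply: eq_bigr => k _; rewrite /num_self_dual cardsE.
have comp_inj : {in [set I | ideal_set I && (I == orthogonal_ideal tau I)] &,
    injective component}.
  move=> I I'; rewrite !inE => /andP[idI _] /andP[idI' _] eqc.
  by rewrite -(glue_component idI) -(glue_component idI') eqc.
rewrite /num_self_dual -(card_in_imset comp_inj); apply: eq_card => J.
apply/imsetP/familyP => [[I + ->] k | JF].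
  rewrite inE => /andP[idI /eqP I_sd]; rewrite !unfold_in component_ideal //=.
  (* The orthogonal components are repackaged as a finite function so that [component_glue]
     applies. *)
  pose D : {dffun forall k, {set B k}} :=
    [ffun k => orthogonal_ideal (@tauB k) (component I k)].
  have DE j : D j = orthogonal_ideal (@tauB j) (component I j) by rewrite [LHS]ffunE.
  have : component (glue D) = component I.
    congr component; rewrite [RHS]I_sd orthogonal_glue.
    by apply/setP=> x; apply/glueP/glueP => xD j; have := xD j; rewrite DE.
  rewrite component_glue => [{1}<-|j]; last by rewrite DE.
  by rewrite DE.
have idJ k : ideal_set (J k) by have := JF k; rewrite unfold_in => /andP[].
exists (glue J); last by rewrite component_glue.
rewrite inE glue_ideal //= orthogonal_glue component_glue //.
apply/eqP/setP=> x; apply/glueP/glueP => xJ k; have := xJ k;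
  by have := JF k; rewrite unfold_in => /andP[_ /eqP <-].
Qed.

End Product.

HB.instance Definition _ (A B : finComNzRingType) := Finite.on (A * B)%type.

(** * Two factors exchanged by the involution *)

Section Swap.

Variables (A : finComNzRingType) (tau : {rmorphism A -> A}).
Hypothesis orthogonalK :
  forall I, ideal_set I -> orthogonal_ideal tau (orthogonal_ideal tau I) = I.

Definition swap_morphism (x : A * A) : A * A := (tau x.2, tau x.1).

Lemma orthogonal_swap_ideal (J : {set A * A}) : ideal_set (orthogonal_ideal swap_morphism J).
Proof.
by apply: orthogonal_ideal_set => x y; rewrite /swap_morphism /= ?rmorphD ?rmorphM.
Qed.

Lemma num_self_dual_swap : num_self_dual swap_morphism = num_ideals A.
Proof.
pose double (I : {set A}) := setX I (orthogonal_ideal tau I).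
have dP I w : (w \in double I) = (w.1 \in I) && (w.2 \in orthogonal_ideal tau I).
  by case: w => w1 w2; rewrite in_setX.
have double_inj : {in [set I | ideal_set I] &, injective double}.
  move=> I I' _ _ /setP eqD; apply/setP=> x.
  by have := eqD (x, 0); rewrite !in_setX;
    have /ideal_setP[-> _] := orthogonal_ideal_rmorph tau I;
    have /ideal_setP[-> _] := orthogonal_ideal_rmorph tau I'; rewrite !andbT.
rewrite /num_ideals -(card_in_imset double_inj); apply: eq_card => J.
rewrite inE; apply/idP/imsetP => [/andP[idJ /eqP J_sd] | [I + ->]].
  pose J1 := [set x | (x, 0) \in J].
  have idJ1 : ideal_set J1.
    apply/ideal_setP; split=> [|a x y]; first by rewrite inE; case/ideal_setP: idJ.
    rewrite !inE => xJ yJ; have /ideal_setP[_ /(_ (a, 0) _ _ xJ yJ)] := idJ.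
    by congr (_ \in J); congr (_, _); rewrite /= mul0r addr0.
  exists J1; first by rewrite inE.
  (* Multiplication by the idempotents (1, 0) and (0, 1) splits J into a product. *)
  have JE x y : ((x, y) \in J) = ((x, 0) \in J) && ((0, y) \in J).
    apply/idP/andP => [xyJ|[xJ yJ]].
      split; [have := ideal_setM (1, 0) idJ xyJ | have := ideal_setM (0, 1) idJ xyJ].
        by congr (_ \in J); congr (_, _); rewrite /= ?mul1r ?mul0r.
      by congr (_ \in J); congr (_, _); rewrite /= ?mul1r ?mul0r.
    have := ideal_setD idJ xJ yJ.
    by congr (_ \in J); congr (_, _); rewrite /= ?addr0 ?add0r.
  apply/setP=> -[x y]; rewrite in_setX JE inE; congr (_ && _).
  rewrite {1}J_sd; apply/orthogonal_idealP/orthogonal_idealP => yJ.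
    move=> u; rewrite inE => uJ; have := yJ _ uJ.
    by move/(congr1 fst).
  move=> [u1 u2]; rewrite JE => /andP[u1J _].
  have := yJ u1; rewrite inE => /(_ u1J) yJ1.
  by congr (_, _); rewrite /= ?yJ1 // rmorph0 mulr0.
rewrite inE => idI; have I0 : 0 \in I by case/ideal_setP: idI.
have O0 : 0 \in orthogonal_ideal tau I by case/ideal_setP: (orthogonal_ideal_rmorph tau I).
apply/andP; split.
  apply/ideal_setP; split=> [|a x y]; first by rewrite in_setX I0 O0.
  rewrite !dP => /andP[x1I x2I] /andP[y1I y2I]; apply/andP; split.
    by case/ideal_setP: idI => _; apply.
  by case/ideal_setP: (orthogonal_ideal_rmorph tau I) => _; apply.
apply/eqP/setP=> -[v1 v2]; rewrite in_setX /=.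
apply/idP/orthogonal_idealP => [/andP[v1I /orthogonal_idealP v2I] [u1 u2] | vI].
  rewrite in_setX /= => /andP[u1I u2I].
  congr (_, _) => /=; first exact: v2I.
  by move: v1I; rewrite -(orthogonalK idI) => /orthogonal_idealP; apply.
apply/andP; split.
  rewrite -(orthogonalK idI); apply/orthogonal_idealP=> u uO.
  have := vI (0, u); rewrite in_setX /= I0 uO => /(_ isT).
  by move/(congr1 snd).
apply/orthogonal_idealP=> u uI.
have := vI (u, 0); rewrite in_setX /= O0 uI => /(_ isT).
by move/(congr1 fst).
Qed.

End Swap.

(** * Double duals over Galois rings *)

Section DoubleDual.

Variables (p r : nat) (R : finComNzRingType) (k : finFieldType).
Variable rho : {rmorphism R -> k}.
Hypothesis rhoP : residue_map p r rho.
Variable n : nat.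
Implicit Types (C D : {set 'rV[R]_n}) (u v : 'rV[R]_n).

Lemma submoduleP C :
  reflect (0 \in C /\ forall a u v, u \in C -> v \in C -> a *: u + v \in C)
    (submodule C).
Proof.
apply: (iffP andP) => [[C0 /forallP CP]|[C0 CP]]; split=> //.
  by move=> a u v uC vC; have /forall_inP/(_ u uC)/forall_inP/(_ v vC) := CP a.
by apply/forallP=> a; apply/forall_inP=> u uC; apply/forall_inP=> v vC; apply: CP.
Qed.

Definition dotr u v : R := \sum_i u 0 i * v 0 i.

Lemma dotrC u v : dotr u v = dotr v u.
Proof. by apply: eq_bigr => i _; rewrite mulrC. Qed.

Lemma dotr_linear a u u' v : dotr (a *: u + u') v = a * dotr u v + dotr u' v.
Proof.
rewrite /dotr mulr_sumr -big_split; apply: eq_bigr => i _ /=.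
by rewrite !mxE mulrDl mulrA.
Qed.

Lemma dotr0 v : dotr 0 v = 0.
Proof. by rewrite /dotr big1 // => i _; rewrite mxE mul0r. Qed.

Lemma dual_codeP C v :
  reflect (forall u, u \in C -> dotr u v = 0) (v \in dual_code id C).
Proof. by rewrite inE; apply: (iffP forall_inP) => h u /h => [/eqP|/eqP]. Qed.

Lemma dual_code_submodule C : submodule (dual_code id C).
Proof.
apply/submoduleP; split=> [|a u v /dual_codeP uC /dual_codeP vC].
  by apply/dual_codeP=> u _; rewrite dotrC dotr0.
by apply/dual_codeP=> w wC; rewrite dotrC dotr_linear ![dotr _ w]dotrC uC // vC // mulr0 addr0.
Qed.

Lemma submoduleZ C a u : submodule C -> u \in C -> a *: u \in C.
Proof. by case/submoduleP=> C0 CP uC; rewrite -[_ *: _]addr0; apply: CP. Qed.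

Lemma submoduleB C u v : submodule C -> u \in C -> v \in C -> u - v \in C.
Proof. by case/submoduleP=> C0 CP uC vC; rewrite addrC -scaleN1r; apply: CP. Qed.

Lemma submoduleD C u v : submodule C -> u \in C -> v \in C -> u + v \in C.
Proof. by case/submoduleP=> C0 CP uC vC; rewrite -[u]scale1r; apply: CP. Qed.

Definition extend C u : {set 'rV[R]_n} := [set w | [exists t, w - t *: u \in C]].

(** With s a section of rho, the elements s(a) u + x for a in k and x in C are distinct: for a and b
    different, s(a) - s(b) is a unit, and a coincidence would put u in C. *)
Lemma card_extend C u :
  submodule C -> u \notin C -> (#|k| * #|C| <= #|extend C u|)%N.
Proof.
have [s sK] := fin_all_exists (residue_surj rhoP).
move=> subC uC; have -> : (#|k| * #|C| = #|setX [set: k] C|)%N by rewrite cardsX cardsT.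
pose f (ax : k * 'rV[R]_n) := s ax.1 *: u + ax.2.
have f_inj : {in setX [set: k] C &, injective f}.
  move=> [a x] [b y]; rewrite !in_setX /= => /andP[_ xC] /andP[_ yC]; rewrite /f /= => eqf.
  have abC : (s a - s b) *: u \in C.
    have -> : (s a - s b) *: u = y - x.
      by rewrite scalerBl; apply/eqP; rewrite subr_eq addrAC eq_sym subr_eq addrC eqf addrC.
    exact: submoduleB.
  have eq_ab : a = b.
    apply/eqP; apply: contraNT uC; rewrite -subr_eq0 -(sK a) -(sK b) -rmorphB.
    case/(residue_unit rhoP) => w ww1.
    by rewrite -[u]scale1r -ww1 mulrC -scalerA submoduleZ.
  by move: eqf; rewrite eq_ab => /addrI ->.
rewrite -(card_in_imset f_inj); apply/subset_leq_card/subsetP=> w.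
case/imsetP=> -[a x]; rewrite in_setX => /andP[_ xC] ->.
by rewrite inE; apply/existsP; exists (s a); rewrite /f /= addrAC subrr add0r.
Qed.

(** yp depends only on the residue of y, so [dotr u] takes at most |k| values on the dual of C. Two
    elements of one fibre differ by a vector orthogonal to both C and u. *)
Lemma card_dual_extend C u :
  submodule C -> p%:R *: u \in C ->
  (#|dual_code id C| <= #|k| * #|dual_code id (extend C u)|)%N.
Proof.
have [s sK] := fin_all_exists (residue_surj rhoP).
move=> subC puC; pose P := [set s a *+ p | a in [set: k]].
have cardP : (#|P| <= #|k|)%N by rewrite -cardsT leq_imset_card.
have dotP v : v \in dual_code id C -> dotr u v \in P.
  move=> /dual_codeP/(_ _ puC); rewrite -[_ *: u]addr0 dotr_linear dotr0 addr0 mulr_natl.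
  move=> /(residue_tors rhoP)/(residue_ker rhoP)[y ->].
  apply/imsetP; exists (rho y) => //;
    have [z zE] := @residue_eqP _ _ _ _ _ rhoP y (s (rho y)) (esym (sK _)).
  by rewrite {1}zE mulrnDl (residue_sqr rhoP) addr0.
rewrite -sum1_card (partition_big (fun v => dotr u v) (fun y => y \in P)) /=; last exact: dotP.
apply: (@leq_trans (\sum_(y in P) #|dual_code id (extend C u)|)); last first.
  by rewrite sum_nat_const leq_mul2r cardP orbT.
apply: leq_sum => y _; rewrite sum1_card.
set F := [pred v | (v \in dual_code id C) && (dotr u v == y)].
have [w wF | F0] := pickP F; last by rewrite eq_card0.
have /andP[wC /eqP uw] := wF.
have sub_inj : injective (fun v => v - w) by move=> v v'; apply: addIr.
rewrite -(card_imset _ sub_inj); apply/subset_leq_card/subsetP=> x.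
case/imsetP=> v /andP[vC /eqP uv] ->.
apply/dual_codeP=> z; rewrite inE => /existsP[t zC].
have /dual_codeP vwC : v - w \in dual_code id C.
  by apply: submoduleB => //; apply: dual_code_submodule.
rewrite (_ : z = t *: u + (z - t *: u)); last by rewrite addrC subrK.
rewrite dotr_linear (vwC _ zC) addr0 dotrC -scaleN1r [v + _]addrC dotr_linear.
by rewrite ![dotr _ u]dotrC uv uw mulN1r addNr mulr0.
Qed.

Let F C := (#|C| * #|dual_code id C|)%N.

Lemma extend_submodule C u : submodule C -> submodule (extend C u).
Proof.
move=> subC; apply/submoduleP; split.
  by rewrite inE; apply/existsP; exists 0; rewrite scale0r subr0; case/submoduleP: subC.
move=> a x y; rewrite !inE => /existsP[t xC] /existsP[t' yC].
apply/existsP; exists (a * t + t').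
have -> : a *: x + y - (a * t + t') *: u = a *: (x - t *: u) + (y - t' *: u).
  by rewrite scalerBr scalerDl scalerA opprD addrACA.
by case/submoduleP: subC => _; apply.
Qed.

(* Adjoining u with p u in C to C multiplies #|C| by at least #|k| and divides the
   size of the dual by at most #|k|, because the functional [dotr u] maps the dual
   of C into pR. Both extremes of a maximal chain have F = #|R|^n. *)
Lemma card_dual_mono C D : submodule C -> submodule D -> C \subset D -> (F C <= F D)%N.
Proof.
have [e] := ubnP (#|D| - #|C|); elim: e C => // e IHe C leD subC subD CD.
have [/eqP|] := boolP (C == D); first by move->.
rewrite eqEsubset CD /= => /subsetPn[u0 u0D u0C].
(* Either u0 or p u0 will do: p(p u0) = 0 lies in C. *)
have [u [uD uC puC]] : exists u, [/\ u \in D, u \notin C & p%:R *: u \in C].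
  have [pC|pC] := boolP (p%:R *: u0 \in C); first by exists u0.
  exists (p%:R *: u0); split=> //; first exact: submoduleZ.
  rewrite scalerA -natrM mulrnA (residue_sqr rhoP) scale0r.
  by case/submoduleP: subC.
have leFC : (F C <= F (extend C u))%N.
  rewrite /F (leq_trans (leq_mul (leqnn _) (card_dual_extend subC puC))) //.
  by rewrite mulnA leq_mul2r mulnC card_extend // orbT.
have subext : extend C u \subset D.
  apply/subsetP=> w; rewrite inE => /existsP[t wC]; rewrite -[w](subrK (t *: u)).
  by apply: submoduleD => //; [apply: (subsetP CD) | apply: submoduleZ].
have k_gt1 : (1 < #|k|)%N by apply: card_finNzRing_gt1.
have C_gt0 : (0 < #|C|)%N by apply/card_gt0P; exists 0; case/submoduleP: subC.
have ltC : (#|C| < #|extend C u|)%N.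
  by apply: leq_trans (card_extend subC uC); rewrite -{1}[#|C|]mul1n ltn_mul2r C_gt0.
apply: leq_trans leFC (IHe _ _ (extend_submodule u subC) subD subext).
move: leD; rewrite !ltnS => leD; apply: leq_trans leD; apply: ltn_sub2l => //.
by apply: leq_trans ltC _; apply: subset_leq_card.
Qed.

Lemma card_dual_code C : submodule C -> (#|C| * #|dual_code id C| = #|{: 'rV[R]_n}|)%N.
Proof.
move=> subC; apply/eqP; rewrite eqn_leq -/(F C).
have sub0 : submodule [set 0 : 'rV[R]_n].
  apply/submoduleP; split=> [|a u v]; rewrite !inE // => /eqP-> /eqP->.
  by rewrite scaler0 addr0.
have subT : submodule [set: 'rV[R]_n] by apply/submoduleP; split=> *; rewrite inE.
have FT : F setT = #|{: 'rV[R]_n}|.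
  rewrite /F cardsT (_ : dual_code id setT = [set 0]) ?cards1 ?muln1 //.
  apply/setP=> v; rewrite in_set1; apply/dual_codeP/eqP => [vT|-> u _]; last first.
    by rewrite dotrC dotr0.
  apply/rowP=> i; have := vT (delta_mx 0 i) (in_setT _).
  rewrite /dotr (bigD1 i) //= big1 => [|j neq_ji].
    by rewrite !mxE !eqxx mul1r addr0.
  by rewrite mxE (negPf neq_ji) andbF mul0r.
have F0 : F [set 0] = #|{: 'rV[R]_n}|.
  rewrite /F cards1 mul1n -cardsT; apply: eq_card => v; rewrite in_setT.
  by apply/dual_codeP=> u /set1P ->; apply: dotr0.
rewrite -{1}FT -F0 !card_dual_mono ?subsetT // sub1set.
by case/submoduleP: subC.
Qed.

Lemma dual_codeK C : submodule C -> dual_code id (dual_code id C) = C.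
Proof.
move=> subC; apply/esym/eqP; rewrite eqEcard; apply/andP; split.
  by apply/subsetP=> u uC; apply/dual_codeP=> v /dual_codeP/(_ _ uC); rewrite dotrC.
have subC' := dual_code_submodule C.
have D_gt0 : (0 < #|dual_code id C|)%N by apply/card_gt0P; exists 0; case/submoduleP: subC'.
by rewrite -(leq_pmul2l D_gt0) (card_dual_code subC') mulnC (card_dual_code subC).
Qed.

End DoubleDual.

(** * Cyclic codes as ideals *)

Definition cyclic_algebra (R : finComNzRingType) (n : nat) : finComNzRingType :=
  {poly %/ ('X^n - 1 : {poly R})}.

Lemma imset_bij (aT rT : finType) (f : aT -> rT) :
  bijective f -> bijective (fun C : {set aT} => f @: C).
Proof.
case=> g fK gK; exists (fun D : {set rT} => g @: D) => C.
  by rewrite -imset_comp (eq_imset _ fK) imset_id.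
by rewrite -imset_comp (eq_imset _ gK) imset_id.
Qed.

Section CyclicAlgebra.

Variables (R : finComNzRingType) (n : nat).
Hypothesis n_gt0 : (0 < n)%N.

Local Notation A := (cyclic_algebra R n).
Local Notation h := ('X^n - 1 : {poly R}).
Definition cyc_const : {rmorphism R -> A} := qpolyC h.
Definition cyc_gen : A := in_qpoly h 'X.
Local Notation c := cyc_const.
Local Notation x := cyc_gen.

Let h_monic : h \is monic.
Proof. by rewrite -[1]/(1%:P) monicXnsubC. Qed.

Let size_h : size h = n.+1.
Proof. by rewrite -[1]/(1%:P) size_XnsubC. Qed.

Let h_gt1 : (1 < size h)%N.
Proof. by rewrite size_h ltnS. Qed.

Lemma cyc_gen_expn : x ^+ n = 1.
Proof.
apply/eqP; rewrite -subr_eq0 /x -rmorphXn -(rmorph1 (in_qpoly h)) -rmorphB.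
apply/eqP/val_inj; rewrite /= /mk_monic h_gt1 h_monic.
exact: Pdiv.RingMonic.rmodpp.
Qed.

Lemma cyc_gen_modn i : x ^+ (i %% n) = x ^+ i.
Proof. exact: expr_mod cyc_gen_expn. Qed.

Lemma card_cyclic_algebra : #|A| = (#|R| ^ n)%N.
Proof. by rewrite card_monic_qpoly // size_h. Qed.

Lemma cyclic_algebra_lift (S : comNzRingType) (iota : {rmorphism R -> S}) (z : S) :
  z ^+ n = 1 -> exists phi : {rmorphism A -> S}, (forall a, phi (c a) = iota a) /\ phi x = z.
Proof.
move=> zn1; have [|phi phiE] := @qpoly_lift _ _ h iota z h_monic h_gt1.
  by rewrite rmorphB rmorphXn rmorph1 /= map_polyX !hornerE zn1 subrr.
exists phi; split=> [a|]; last by rewrite /x phiE map_polyX hornerX.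
by rewrite /c /= -[qpolyC h a]in_qpoly_val phiE /= map_polyC hornerC.
Qed.

Lemma eq_cyclic_rmorph (S : comNzRingType) (phi psi : {rmorphism A -> S}) :
  (forall a, phi (c a) = psi (c a)) -> phi x = psi x -> phi =1 psi.
Proof. exact: eq_qpoly_rmorph. Qed.

Definition cyc_coef (j : nat) (w : A) : R := (w : {poly R})`_j.

Lemma cyc_coef_sum (I : Type) (s : seq I) (P : pred I) (F : I -> A) j :
  cyc_coef j (\sum_(i <- s | P i) F i) = \sum_(i <- s | P i) cyc_coef j (F i).
Proof. by rewrite /cyc_coef coefn_sum. Qed.

Lemma cyc_coefE j a i :
  (j < n)%N -> cyc_coef j (c a * x ^+ i) = a *+ (j == i %% n)%N.
Proof.
move=> lt_jn; rewrite -cyc_gen_modn.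
have lt_in : (i %% n < n)%N by rewrite ltn_mod.
have -> : c a * x ^+ (i %% n) = in_qpoly h (a *: 'X^(i %% n)).
  by rewrite -mul_polyC in_qpolyM rmorphXn -[c a]in_qpoly_val.
rewrite /cyc_coef in_qpoly_small ?coefZ ?coefXn ?mulr_natr //.
rewrite /mk_monic h_gt1 h_monic size_h ltnS.
by rewrite (leq_trans (size_scale_leq _ _)) // size_polyXn.
Qed.

Lemma cyc_coef_inj (w w' : A) :
  (forall j, (j < n)%N -> cyc_coef j w = cyc_coef j w') -> w = w'.
Proof.
move=> eqw; apply: val_inj; apply/polyP=> j; have [lt_jn|le_nj] := ltnP j n.
  exact: eqw.
have sz (v : A) : (size (v : {poly R}) <= j)%N.
  by apply: leq_trans le_nj; rewrite -ltnS -size_h size_qpoly.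
by rewrite !nth_default ?sz.
Qed.

Definition code_elt (u : 'rV[R]_n) : A := \sum_i c (u 0 i) * x ^+ i.

Lemma cyc_coef_code_elt u (i : 'I_n) : cyc_coef i (code_elt u) = u 0 i.
Proof.
rewrite cyc_coef_sum (bigD1 i) //= cyc_coefE // modn_small // eqxx.
rewrite big1 ?addr0 // => j neq_ji; rewrite cyc_coefE // modn_small //.
by rewrite eq_sym (inj_eq val_inj) (negPf neq_ji).
Qed.

Lemma code_elt_bij : bijective code_elt.
Proof.
exists (fun w => \row_i cyc_coef i w) => [u|w].
  by apply/rowP=> i; rewrite mxE cyc_coef_code_elt.
apply: cyc_coef_inj => j lt_jn.
by rewrite (cyc_coef_code_elt _ (Ordinal lt_jn)) mxE.
Qed.

Lemma code_elt_linear a u v : code_elt (a *: u + v) = c a * code_elt u + code_elt v.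
Proof.
rewrite /code_elt mulr_sumr -big_split; apply: eq_bigr => i _ /=.
by rewrite !mxE rmorphD rmorphM mulrDl mulrA.
Qed.

Lemma code_elt0 : code_elt 0 = 0.
Proof. by rewrite /code_elt big1 // => i _; rewrite mxE rmorph0 mul0r. Qed.

Lemma code_elt_shift u : code_elt (cyclic_shift u) = x * code_elt u.
Proof.
rewrite /code_elt (reindex_inj (can_inj (@ordSK n))) mulr_sumr.
apply: eq_bigr => i _; rewrite mxE ordSK /= cyc_gen_modn exprS.
by rewrite mulrCA.
Qed.

Lemma cyclic_algebra_sum (w : A) : w = \sum_(i < n) c (cyc_coef i w) * x ^+ i.
Proof.
apply: cyc_coef_inj => j lt_jn; rewrite cyc_coef_sum (bigD1 (Ordinal lt_jn)) //=.
rewrite cyc_coefE // modn_small // eqxx big1 ?addr0 // => i neq_ij.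
by rewrite cyc_coefE // modn_small // eq_sym (negPf neq_ij : (i == j :> nat) = false).
Qed.

Lemma cyclic_code_ideal C : cyclic_code C = ideal_set (code_elt @: C).
Proof.
have inj := bij_inj code_elt_bij.
apply/andP/ideal_setP => [[/submoduleP[C0 CP] /forall_inP Cs]|[I0 IP]].
  have I0 : 0 \in code_elt @: C by rewrite -code_elt0 imset_f.
  have Iadd b v w : v \in code_elt @: C -> w \in code_elt @: C -> c b * v + w \in code_elt @: C.
    case/imsetP=> u uC -> /imsetP[u' u'C ->]; rewrite -code_elt_linear imset_f //.
    exact: CP.
  have Ix i v : v \in code_elt @: C -> x ^+ i * v \in code_elt @: C.
    move=> vC; elim: i => [|i]; rewrite ?mul1r // exprS -mulrA.
    by case/imsetP=> u uC ->; rewrite -code_elt_shift imset_f // Cs.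
  have IaddI v w : v \in code_elt @: C -> w \in code_elt @: C -> v + w \in code_elt @: C.
    by move=> vC wC; rewrite -[v]mul1r -(rmorph1 c) Iadd.
  split=> // a v w vC wC; apply: (IaddI) => //.
  rewrite [a]cyclic_algebra_sum mulr_suml.
  apply: (big_ind (fun y => y \in code_elt @: C)); [by [] | exact: IaddI | move=> i _].
  rewrite -mulrA -[_ * _]addr0.
  by apply: Iadd => //; apply: Ix.
have memC u : (u \in C) = (code_elt u \in code_elt @: C) by rewrite mem_imset.
split.
  apply/submoduleP; split=> [|a u v]; rewrite !memC ?code_elt0 // code_elt_linear.
  exact: IP.
apply/forall_inP=> u; rewrite !memC code_elt_shift => uC.
by rewrite -[_ * _]addr0; apply: IP.
Qed.

(** All coefficients become constant coefficients after a shift; on an ideal it is thus enough to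
    control the constant ones. *)
Lemma cyc_coef_shift j w : (j < n)%N -> cyc_coef 0 (x ^+ (n - j) * w) = cyc_coef j w.
Proof.
move=> lt_jn; rewrite [w in LHS]cyclic_algebra_sum mulr_sumr cyc_coef_sum.
have term i : x ^+ (n - j) * (c (cyc_coef i w) * x ^+ i) = c (cyc_coef i w) * x ^+ (n - j + i).
  by rewrite mulrCA -exprD.
rewrite (bigD1 (Ordinal lt_jn)) //= term cyc_coefE // subnK 1?ltnW // modnn.
rewrite big1 ?addr0 // => i neq_ij; rewrite term cyc_coefE //.
suff -> : (0%N == (n - j + i) %% n)%N = false by [].
apply: contraNF neq_ij => i_eq_j; apply/eqP/val_inj => /=.
rewrite -(modn_small (ltn_ord i)) -(modn_small lt_jn); apply/eqP.
by rewrite -(eqn_modDl (n - j)) subnK 1?ltnW // modnn eq_sym.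
Qed.

Section Dual.

Variables (sigma : {rmorphism R -> R}) (tau : {rmorphism A -> A}).
Hypotheses (tau_const : forall a, tau (c a) = c (sigma a)) (tau_gen : tau x = x ^+ n.-1).

(** The image of x^j under tau is x^(-j), written x^((n-1)j), so only the terms with i = j
    contribute to the constant coefficient. *)
Lemma cyc_coef0_mul u v :
  cyc_coef 0 (code_elt u * tau (code_elt v)) = \sum_i u 0 i * sigma (v 0 i).
Proof.
rewrite /code_elt rmorph_sum big_distrlr /= cyc_coef_sum; apply: eq_bigr => i _.
have term j : c (u 0 i) * x ^+ i * tau (c (v 0 j) * x ^+ j) =
    c (u 0 i * sigma (v 0 j)) * x ^+ (i + n.-1 * j).
  by rewrite rmorphM rmorphXn tau_const tau_gen -exprM mulrACA -(rmorphM c) -exprD.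
rewrite cyc_coef_sum (bigD1 i) //= term cyc_coefE // -mulSn prednK // modnMr.
rewrite big1 ?addr0 // => j neq_ji; rewrite term cyc_coefE //.
suff -> : (0%N == (i + n.-1 * j) %% n)%N = false by [].
apply: contraNF neq_ji; rewrite eq_sym => i_eq_j; rewrite eq_sym; apply/eqP/val_inj.
rewrite /= -(modn_small (ltn_ord i)) -(modn_small (ltn_ord j)); apply/eqP.
rewrite -(eqn_modDr (n.-1 * j)) -mulSn prednK // modnMr.
exact: i_eq_j.
Qed.

(** The inner product sees only the constant coefficient of the product with the image under tau;
    the other coefficients are reached because the ideal is stable under multiplication by powers of
    x. *)
Lemma code_elt_dual f C : f =1 sigma -> cyclic_code C ->
  code_elt @: dual_code f C = orthogonal_ideal tau (code_elt @: C).
Proof.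
have inj := bij_inj code_elt_bij; have [g _ gK] := code_elt_bij.
move=> fE; rewrite cyclic_code_ideal => idC; apply/setP=> w; rewrite -[w]gK mem_imset //.
move: (g w) => v; rewrite inE; apply/forall_inP/orthogonal_idealP => vC; last first.
  move=> u uC; have := vC _ (imset_f code_elt uC) => /(congr1 (cyc_coef 0)).
  rewrite cyc_coef0_mul /cyc_coef coef0 => uv0; apply/eqP; rewrite -[RHS]uv0.
  by apply: eq_bigr => i _; rewrite fE.
move=> w' w'C; apply: cyc_coef_inj => j lt_jn; rewrite [RHS]coef0 -cyc_coef_shift //.
have /imsetP[u uC uE] := ideal_setM (x ^+ (n - j)) idC w'C.
rewrite mulrA uE cyc_coef0_mul -[RHS](eqP (vC u uC)).
by apply: eq_bigr => i _; rewrite fE.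
Qed.

(** The function f need only agree pointwise with the morphism sigma, which admits [galois_conj]. *)
Lemma num_self_dual_codes f : f =1 sigma ->
  #|[set C : {set 'rV[R]_n} | cyclic_code C && (C == dual_code f C)]| = num_self_dual tau.
Proof.
move=> fE; have inj := bij_inj code_elt_bij.
rewrite /num_self_dual -(on_card_preimset (onW_bij _ (imset_bij code_elt_bij))).
apply: eq_card => C; rewrite !inE -cyclic_code_ideal.
have [cycC|//] := boolP (cyclic_code C).
by rewrite -(code_elt_dual fE cycC) (inj_eq (imset_inj inj)).
Qed.

End Dual.

Lemma num_cyclicE : num_cyclic R n = num_ideals A.
Proof.
rewrite /num_ideals -(on_card_preimset (onW_bij _ (imset_bij code_elt_bij))).
by apply: eq_card => C; rewrite !inE cyclic_code_ideal.
Qed.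

Lemma orthogonal_idealK p r (k : finFieldType) (rho : {rmorphism R -> k})
    (tau : {rmorphism A -> A}) I :
  residue_map p r rho -> (forall a, tau (c a) = c a) -> tau x = x ^+ n.-1 ->
  ideal_set I -> orthogonal_ideal tau (orthogonal_ideal tau I) = I.
Proof.
move=> rhoP tau_c tau_x idI.
have [f fK gK] := imset_bij code_elt_bij.
rewrite -(gK I) in idI *; move: (f I) idI => C; rewrite -cyclic_code_ideal => cycC.
have dualE C' : cyclic_code C' -> code_elt @: dual_code id C' =
    orthogonal_ideal tau (code_elt @: C').
  exact: (@code_elt_dual idfun).
rewrite -dualE // -dualE; last first.
  by rewrite cyclic_code_ideal dualE // orthogonal_ideal_rmorph.
by rewrite (dual_codeK rhoP) //; case/andP: cycC.
Qed.

End CyclicAlgebra.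

(** * Cyclotomic cosets *)

Local Close Scope ring_scope.

Lemma opp_modE m (h k : 'I_m) : ((h + k) %% m == 0)%N = (k == opp_mod h).
Proof.
have lt_h := ltn_ord h; have lt_k := ltn_ord k.
rewrite -val_eqE /=; have [->|h_gt0] := posnP h.
  by rewrite add0n subn0 modnn modn_small.
rewrite [((m - h) %% m)%N]modn_small; last by lia.
have [lt|le] := ltnP (h + k) m; first by rewrite modn_small //; lia.
rewrite -{1}[(h + k)%N](subnK le) modnDr modn_small; lia.
Qed.

Lemma opp_modK m : involutive (@opp_mod m).
Proof.
move=> h; apply/esym/eqP; rewrite -opp_modE addnC opp_modE.
exact: eqxx.
Qed.

(** The solutions of 2h = 0 modulo m, those for which zeta^h is its own inverse. *)
Lemma I0_opp m (h : 'I_m) : (h \in I0 m) = (opp_mod h == h).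
Proof.
rewrite eq_sym -opp_modE inE; have lt_h := ltn_ord h.
have [->|h_gt0] /= := posnP h; first by rewrite addn0 mod0n.
have -> : ((h + h) %% m == 0)%N = (h + h == m)%N.
  have [lt|le] := ltnP (h + h) m; first by rewrite modn_small //; lia.
  rewrite -{1}[(h + h)%N](subnK le) modnDr modn_small; lia.
have := odd_double_half m; case: (odd m) => /=; lia.
Qed.

Section CosetTheory.

Variables (q m : nat).
Hypothesis coprime_qm : coprime q m.
Implicit Types h k : 'I_m.

Local Notation coset := (cyclotomic_coset q).
Local Notation f := (@mulq_mod q m).

Lemma iter_mulq_mod i h : iter i f h = (h * q ^ i %% m)%N :> nat.
Proof.
elim: i => [|i IHi]; first by rewrite muln1 modn_small.
by rewrite iterS /= IHi modnMml expnSr mulnA.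
Qed.

Lemma iter_mulq_mod_totient h : iter (totient m) f h = h.
Proof.
apply: val_inj; rewrite /= iter_mulq_mod -modnMmr Euler_exp_totient //.
by rewrite modnMmr muln1 modn_small.
Qed.

Lemma mulq_mod_inj : injective f.
Proof.
apply: (can_inj (g := iter (totient m).-1 f)) => h.
have m_gt0 : (0 < m)%N by apply: leq_ltn_trans (ltn_ord h).
by rewrite -iterSr prednK ?totient_gt0 // iter_mulq_mod_totient.
Qed.

Lemma coset_refl h : h \in coset h.
Proof. by rewrite inE connect0. Qed.

Lemma coset_eq h k : k \in coset h -> coset k = coset h.
Proof.
rewrite inE => hk; apply/setP=> l; rewrite !inE.
by rewrite -(same_connect (fconnect_sym mulq_mod_inj) hk).
Qed.

Lemma card_coset h : #|coset h| = fingraph.order f h.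
Proof. by rewrite cardsE. Qed.

Lemma card_coset_gt0 h : (0 < #|coset h|)%N.
Proof. by rewrite card_coset fingraph.order_gt0. Qed.

Lemma mulq_exp_card_coset h : (h * q ^ #|coset h| = h %[mod m])%N.
Proof.
by rewrite -iter_mulq_mod card_coset iter_order ?modn_small //; apply: mulq_mod_inj.
Qed.

Lemma coset_fixed h : f h = h -> coset h = [set h].
Proof.
move=> fh; apply/setP=> k; rewrite in_set1 inE; apply/idP/eqP => [/iter_findex <-|->].
  by elim: (findex _ _ _) => //= i ->.
exact: connect0.
Qed.

Lemma opp_mulq_mod h : opp_mod (f h) = f (opp_mod h).
Proof.
apply/esym/eqP; rewrite -opp_modE /= modnDm -mulnDl -modnMml.
by have /eqP -> : ((h + opp_mod h) %% m == 0)%N; rewrite ?opp_modE ?mul0n ?mod0n.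
Qed.

Lemma opp_iter_mulq_mod i h : opp_mod (iter i f h) = iter i f (opp_mod h).
Proof. by elim: i => //= i IHi; rewrite opp_mulq_mod IHi. Qed.

Lemma coset_opp h : coset (opp_mod h) = [set opp_mod k | k in coset h].
Proof.
apply/setP=> k; apply/idP/imsetP => [|[l]]; rewrite inE.
  move/iter_findex <-; exists (iter (findex f (opp_mod h) k) f h).
    by rewrite inE fconnect_iter.
  by rewrite opp_iter_mulq_mod.
by move/iter_findex => <- ->; rewrite inE opp_iter_mulq_mod fconnect_iter.
Qed.

Lemma card_coset_opp h : #|coset (opp_mod h)| = #|coset h|.
Proof. by rewrite coset_opp card_imset //; apply: can_inj (@opp_modK m). Qed.

(** If m = 2h, then q is odd, being prime to m, and hq = h + ((q - 1)/2) m. *)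
Lemma I0_coset h : h \in I0 m -> coset h = [set h].
Proof.
move=> hI0; apply: coset_fixed; apply: val_inj => /=; move: hI0.
rewrite inE => /orP[/eqP-> | /andP[m_even /eqP hE]]; first by rewrite mul0n mod0n.
have q_odd : odd q.
  apply: contraLR coprime_qm => q_even.
  have : 2 %| gcdn q m by rewrite dvdn_gcd !dvdn2 q_even m_even.
  by apply: contraL => /eqP ->.
have mE : m = (h * 2)%N by rewrite hE muln2 -[in LHS](odd_double_half m) (negPf m_even).
have qE : q = (1 + q./2 * 2)%N by rewrite muln2 -[in LHS](odd_double_half q) q_odd.
have -> : (h * q = q./2 * m + h)%N by nia.
by rewrite modnMDl modn_small.
Qed.

(* In a self-inverse coset outside I0 the first power of q that maps h to -h is
   half of the coset size. *)
Lemma mem_I1 h : h \in I1 q m ->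
  [/\ h \notin I0 m, (#|coset h|./2).*2 = #|coset h| &
      iter #|coset h|./2 f h = opp_mod h].
Proof.
case/bigcupP=> h' /andP[/eqP si_h' ncI0] hh'.
have ceq := coset_eq hh'.
have hI0 : h \notin I0 m.
  by apply: contra ncI0 => hI0; rewrite -ceq I0_coset // sub1set.
have opp_h : fconnect f h (opp_mod h).
  have : opp_mod h \in coset (opp_mod h') by rewrite coset_opp imset_f.
  by rewrite si_h' -ceq inE.
set i := findex f h (opp_mod h).
have iE : iter i f h = opp_mod h by apply: iter_findex.
have lt_i : (i < #|coset h|)%N by rewrite card_coset findex_max.
have small j : (j < #|coset h|)%N -> iter j f h = h -> j = 0.
  by rewrite card_coset => ltj jh; rewrite -(findex_iter ltj) jh findex0.
have i_neq0 : i != 0.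
  by apply: contraNneq hI0 => i0; rewrite I0_opp -iE i0.
have i2E : iter i.*2 f h = h.
  by rewrite -addnn iterD iE -opp_iter_mulq_mod iE opp_modK.
(* As 2i is a period of h and i < |coset h|, 2i is 0 or |coset h|; the value 0 would make h its own
   opposite. *)
have [lt|le] := ltnP i.*2 #|coset h|.
  by have := small _ lt i2E; rewrite -muln2 => /eqP; rewrite muln_eq0 (negPf i_neq0).
have i2 : (i.*2 - #|coset h| = 0)%N.
  apply: small; first by lia.
  rewrite -[in RHS]i2E -{2}(subnK le) iterD card_coset iter_order //.
  exact: mulq_mod_inj.
have -> : #|coset h| = i.*2 by lia.
by rewrite doubleK.
Qed.

Section Transversal.

Variables J I : {set 'I_m}.
Hypothesis trJ : coset_representatives q J I.

Lemma sum_card_coset : (\sum_(h in J) #|coset h| = #|I|)%N.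
Proof.
have partI : partition [set coset h | h in I] I by case/and3P: trJ.
have subJI := transversal_sub trJ.
rewrite (card_partition partI) -{1}(pblock_transversal trJ) big_imset; last first.
  exact: pblock_inj trJ.
apply: eq_bigr => h hJ; rewrite (@def_pblock _ _ (coset h)) ?coset_refl //.
  exact: partition_trivIset partI.
by rewrite imset_f // (subsetP subJI).
Qed.

Lemma coset_representative k : k \in I -> exists2 h, h \in J & k \in coset h.
Proof.
have partI : partition [set coset h | h in I] I by case/and3P: trJ.
move=> kI; have : coset k \in [set coset h | h in I] by rewrite imset_f.
rewrite -{1}(pblock_transversal trJ) => /imsetP[h hJ hk].
exists h => //; rewrite -(@def_pblock _ [set coset h | h in I] (coset h) h) ?coset_refl //.
- by rewrite -hk coset_refl.
- exact: partition_trivIset partI.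
by rewrite imset_f // (subsetP (transversal_sub trJ)).
Qed.

End Transversal.

End CosetTheory.

Local Open Scope ring_scope.

(** * The decomposition of the algebra of cyclic codes *)

(** The coefficient of Y^d in the j-th image is the sum of the b_i zeta^(ji) over i = d modulo N.
    Weighting by zeta^(-je) and summing over j kills all i distinct from e modulo m, as zeta^k - 1
    is a unit when m does not divide k. By Chinese remainders only m b_e is left, and m is a
    unit. *)
Lemma fourier_inj (R S : finComNzRingType) (iota : {rmorphism R -> S}) (m N : nat)
    (zeta : S) (Phi : 'I_m -> {rmorphism cyclic_algebra R (m * N) -> cyclic_algebra S N}) :
  (0 < m)%N -> (0 < N)%N -> coprime m N -> injective iota -> zeta ^+ m = 1 ->
  (forall i, ~~ (m %| i)%N -> exists y, (zeta ^+ i - 1) * y = 1) ->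
  (exists y, m%:R * y = 1 :> S) ->
  (forall j a, Phi j (cyc_const _ _ a) = cyc_const _ _ (iota a)) ->
  (forall j, Phi j (cyc_gen _ _) = cyc_const _ _ (zeta ^+ j) * cyc_gen _ _) ->
  forall x, (forall j, Phi j x = 0) -> x = 0.
Proof.
move=> m_gt0 N_gt0 co_mN iota_inj zeta_m zeta_unit [m' mm'] PhiC PhiX x Phix0.
have n_gt0 : (0 < m * N)%N by rewrite muln_gt0 m_gt0.
apply: (cyc_coef_inj n_gt0) => e lt_e; rewrite [RHS]coef0.
apply: iota_inj; rewrite rmorph0.
pose b (i : nat) := iota (cyc_coef i x).
have sum_d (j : 'I_m) d : (d < N)%N ->
    \sum_(i < m * N) b i * zeta ^+ (j * i) *+ (d == i %% N)%N = 0.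
  move=> lt_d; have := congr1 (cyc_coef d) (Phix0 j).
  rewrite [x in Phi j x](cyclic_algebra_sum n_gt0) rmorph_sum cyc_coef_sum [X in _ = X]coef0.
  move=> {2}<-; apply: eq_bigr => i _; rewrite rmorphM rmorphXn PhiC PhiX exprMn -rmorphXn.
  by rewrite mulrA -rmorphM cyc_coefE // -exprM.
have inner k : \sum_(j < m) zeta ^+ (j * k) = m%:R *+ (m %| k)%N.
  have [/dvdnP[l ->]|ndvd] := boolP (m %| k)%N.
    rewrite (eq_bigr (fun=> 1)) ?sumr_const ?card_ord // => j _.
    by rewrite mulnCA mulnC exprM mulnC exprM zeta_m !expr1n.
  have [y yE] := zeta_unit _ ndvd; rewrite mulr0n.
  have w1 : (zeta ^+ k - 1) * \sum_(j < m) zeta ^+ (j * k) = 0.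
    rewrite (eq_bigr (fun j : 'I_m => (zeta ^+ k) ^+ j)) => [|j _]; last by rewrite mulnC exprM.
    by rewrite -subrX1 -exprM mulnC exprM zeta_m expr1n subrr.
  by rewrite -[LHS]mul1r -yE mulrAC w1 mul0r.
(* The exponent (m - 1)e stands for -e, since zeta^m = 1. *)
have : \sum_(j < m) zeta ^+ (j * (m.-1 * e)) *
    (\sum_(i < m * N) b i * zeta ^+ (j * i) *+ (e %% N == i %% N)%N) = 0.
  by rewrite big1 // => j _; rewrite sum_d ?mulr0 // ltn_mod.
under eq_bigr do rewrite mulr_sumr.
rewrite exchange_big /= (bigD1 (Ordinal lt_e)) //= [X in _ + X]big1 => [|i neq_ie]; last first.
  transitivity (b i * (\sum_(j < m) zeta ^+ (j * (i + m.-1 * e))) *+ (e %% N == i %% N)%N).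
    rewrite mulr_sumr -sumrMnl; apply: eq_bigr => j _.
    by rewrite mulnDr exprD mulrnAr; congr (_ *+ _); rewrite mulrCA [X in _ * X]mulrC.
  rewrite inner; case: eqP => [eqN|_]; last by rewrite mulr0n.
  case: (boolP (m %| _)%N) => [dvd_m|_]; last by rewrite mulr0n mulr0 mul0rn.
  case/eqP: neq_ie; apply: val_inj => /=.
  have eqm : (i == e %[mod m])%N.
    rewrite -(eqn_modDr (m.-1 * e)) -mulSn prednK // modnMr; exact: dvd_m.
  apply/eqP; rewrite -(modn_small (ltn_ord i)) -(modn_small lt_e).
  by rewrite chinese_remainder // eqm eqN eqxx.
rewrite eqxx addr0 => sum0; rewrite -[iota _]mul1r -mm' mulrAC.
suff -> : m%:R * iota (cyc_coef e x) = 0 by rewrite mul0r.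
rewrite -{}sum0 -[m in m%:R]card_ord -sumr_const mulr_suml; apply: eq_bigr => j _.
rewrite mulr1n mul1r mulrCA -exprD -mulnDr addnC -mulSn prednK // mulnCA.
by rewrite exprM zeta_m expr1n mulr1.
Qed.

Lemma expr_expn_id (R : pzSemiRingType) (x : R) Q e : x ^+ Q = x -> x ^+ (Q ^ e) = x.
Proof. by move=> xQ; elim: e => [|e IHe]; rewrite ?expr1 // expnS exprM xQ. Qed.

Lemma cyclic_involution (R : finComNzRingType) N (sigma : {rmorphism R -> R}) :
  (0 < N)%N -> exists tau : {rmorphism cyclic_algebra R N -> cyclic_algebra R N},
    (forall a, tau (cyc_const R N a) = cyc_const R N (sigma a)) /\
    tau (cyc_gen R N) = cyc_gen R N ^+ N.-1.
Proof.
move=> N_gt0; apply: (cyclic_algebra_lift N_gt0 (cyc_const R N \o sigma)).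
by rewrite exprAC cyc_gen_expn // expr1n.
Qed.

(** On the generator, both sides are inverse to its image under [pi]. The condition on z and z'
    covers the three kinds of factors: [pi = pi'] with sigma the identity or the conjugation, or two
    exchanged projections with sigma the identity. *)
Lemma involution_compat (R S : finComNzRingType) (n N : nat) (iota : {rmorphism R -> S})
    (sigma : {rmorphism S -> S}) (z z' : S)
    (tau : {rmorphism cyclic_algebra R n -> cyclic_algebra R n})
    (tauS : {rmorphism cyclic_algebra S N -> cyclic_algebra S N})
    (pi pi' : {rmorphism cyclic_algebra R n -> cyclic_algebra S N}) :
  (0 < n)%N -> (0 < N)%N ->
  (forall a, tau (cyc_const R n a) = cyc_const R n a) ->
  tau (cyc_gen R n) = cyc_gen R n ^+ n.-1 ->
  (forall a, tauS (cyc_const S N a) = cyc_const S N (sigma a)) ->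
  tauS (cyc_gen S N) = cyc_gen S N ^+ N.-1 ->
  (forall a, pi (cyc_const R n a) = cyc_const S N (iota a)) ->
  (forall a, pi' (cyc_const R n a) = cyc_const S N (iota a)) ->
  pi (cyc_gen R n) = cyc_const S N z * cyc_gen S N ->
  pi' (cyc_gen R n) = cyc_const S N z' * cyc_gen S N ->
  (forall a, sigma (iota a) = iota a) -> z * sigma z' = 1 ->
  forall x, pi (tau x) = tauS (pi' x).
Proof.
move=> n_gt0 N_gt0 tauC tauX tauSC tauSX piC pi'C piX pi'X sigma_iota zz'.
apply: (@eq_cyclic_rmorph _ n (cyclic_algebra S N) (pi \o tau) (tauS \o pi')) => [a|] /=.
  by rewrite tauC piC pi'C tauSC sigma_iota.
have inv1 : pi (cyc_gen R n) * pi (tau (cyc_gen R n)) = 1.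
  by rewrite tauX rmorphXn -exprS prednK // -rmorphXn cyc_gen_expn // rmorph1.
have inv2 : tauS (pi' (cyc_gen R n)) * pi (cyc_gen R n) = 1.
  rewrite pi'X piX rmorphM tauSC tauSX mulrACA -exprSr prednK // cyc_gen_expn //.
  by rewrite mulr1 -(rmorphM (cyc_const S N)) mulrC zz' rmorph1.
by rewrite -[LHS]mul1r -inv2 -mulrA inv1 mulr1.
Qed.

(** R consists of the b + cp with b and c fixed by the power p^s, hence by p^(sk); s dividing r
    makes the description of sigma available on their images. *)
Lemma frobenius_fix p s r k (R S : finComNzRingType) (j : {rmorphism R -> S})
    (sigma : {rmorphism S -> S}) :
  prime p -> is_galois_ring p s R -> (s %| r)%N ->
  (forall t, t ^+ (p ^ r) = t -> sigma t = t ^+ (p ^ (s * k))) ->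
  forall a, sigma (j a) = j a.
Proof.
move=> p_pr Rgr /dvdnP[d ->] sigmaE a.
have [b [c [bQ cQ ->]]] := galois_ring_decomposition p_pr a Rgr.
have fixj t : t ^+ (p ^ s) = t -> sigma (j t) = j t.
  move=> tQ; have jtQ : j t ^+ (p ^ s) = j t by rewrite -rmorphXn tQ.
  rewrite sigmaE; first by rewrite expnM expr_expn_id.
  by rewrite mulnC expnM expr_expn_id.
by rewrite !rmorphD !rmorphMn !fixj.
Qed.

Lemma card_I0 m : (0 < m)%N -> #|I0 m| = if odd m then 1%N else 2%N.
Proof.
move=> m_gt0; have [m_odd|m_even] := boolP (odd m).
  rewrite -(cards1 (Ordinal m_gt0)); apply: eq_card => h.
  by rewrite !inE m_odd /= orbF.
have lt_m2 : (m./2 < m)%N by rewrite ltn_half_double -addnn -{1}[m]addn0 ltn_add2l.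
have m2_gt0 : (0 < m./2)%N by have := odd_double_half m; rewrite (negPf m_even); lia.
transitivity #|[set Ordinal m_gt0; Ordinal lt_m2]|; last first.
  by rewrite cards2 -val_eqE /= eq_sym -lt0n m2_gt0.
by apply: eq_card => h; rewrite !inE m_even.
Qed.

Lemma big_three_sets (R : Type) (idx : R) (op : Monoid.com_law idx) (T : finType)
    (A B C : {set T}) (f g e : T -> R) :
  [disjoint A & B] -> [disjoint A & C] -> [disjoint B & C] ->
  \big[op/idx]_(h in A :|: (B :|: C)) (if h \in A then f h else if h \in B then g h else e h) =
  op (\big[op/idx]_(h in A) f h) (op (\big[op/idx]_(h in B) g h) (\big[op/idx]_(h in C) e h)).
Proof.
move=> dAB dAC dBC.
have bigUE (X Y : {set T}) F : [disjoint X & Y] ->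
    \big[op/idx]_(h in X :|: Y) F h = op (\big[op/idx]_(h in X) F h) (\big[op/idx]_(h in Y) F h).
  by move=> dXY; rewrite -bigU //; apply: eq_bigl => h; rewrite !inE.
rewrite bigUE; last by rewrite -setI_eq0 setIUr setU_eq0 !setI_eq0 dAB.
rewrite (bigUE _ _ _ dBC); congr (op _ (op _ _)); apply: eq_bigr => h hX.
- by rewrite hX.
- by rewrite hX (disjointFl dAB).
- by rewrite (disjointFl dAC) // (disjointFl dBC).
Qed.

Lemma disjoint_I0_I1 q m : coprime q m -> [disjoint I0 m & I1 q m].
Proof.
move=> co_qm; rewrite disjoint_sym disjoint_subset; apply/subsetP=> h.
by case/(mem_I1 co_qm).
Qed.

Lemma disjoint_representatives q m (J1 J2 J : {set 'I_m}) :
  coprime q m -> coset_representatives q J1 (I1 q m) ->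
  coset_representatives q J2 (I2 q m) -> J \subset J2 ->
  [/\ [disjoint I0 m & J1], [disjoint I0 m & J] & [disjoint J1 & J]].
Proof.
move=> co_qm /transversal_sub J1I1 /transversal_sub J2I2 JJ2.
have JI2 : J \subset I2 q m := subset_trans JJ2 J2I2.
split; first exact: disjointWr J1I1 (disjoint_I0_I1 co_qm).
  by apply: disjointWr JI2 _; rewrite disjoints_subset setCK subsetUl.
apply: disjointW J1I1 JI2 _.
by rewrite disjoints_subset setCK subsetUr.
Qed.

(* GR(p^2, s k0) contains the m-th roots of unity and all the GR(p^2, s m_h). *)
Lemma exists_common_degree p s m :
  prime p -> ~~ (p %| m)%N -> (0 < m)%N ->
  exists k0, [/\ (0 < k0)%N, (m %| (p ^ (s * k0)).-1)%N &
    forall h : 'I_m, (#|cyclotomic_coset (p ^ s) h| %| k0)%N].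
Proof.
move=> p_pr p_m m_gt0; have co_pm : coprime p m by rewrite prime_coprime.
(* The totient makes m divide q^k0 - 1 by Euler's theorem; the product makes k0 a multiple of each
   coset size. *)
exists (totient m * \prod_(h : 'I_m) #|cyclotomic_coset (p ^ s) h|)%N; split.
- by rewrite muln_gt0 totient_gt0 m_gt0 prodn_gt0 // => h; apply: card_coset_gt0.
- rewrite -subn1 -eqn_mod_dvd ?expn_gt0 ?prime_gt0 // mulnCA expnM.
  by rewrite -modnXm Euler_exp_totient // modnXm exp1n.
- by move=> h; rewrite (bigD1 h) //= mulnCA dvdn_mulr.
Qed.

(** The factor contributed by h; the last branch is meant for h in J2'. For h in [I0] the coset is a
    singleton, hence degree s. *)
Definition local_count (p s m a : nat) (GR : nat -> finComNzRingType) (J1 : {set 'I_m})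
    (h : 'I_m) : nat :=
  let r := (s * #|cyclotomic_coset (p ^ s) h|)%N in
  if h \in I0 m then num_euclidean (GR s) (p ^ a)
  else if h \in J1 then num_hermitian (GR r) (p ^ a) p r
  else num_cyclic (GR r) (p ^ a).

(** * Components attached to the representatives *)

Section Assembly.

Variables (p s m a : nat) (GR : nat -> finComNzRingType).
Hypotheses (p_pr : prime p) (s_gt0 : (0 < s)%N) (m_gt0 : (0 < m)%N)
  (p_m : ~~ (p %| m)%N) (GRP : forall r : nat, (0 < r)%N -> is_galois_ring p r (GR r)).

Local Notation q := (p ^ s)%N.
Local Notation N := (p ^ a)%N.
Local Notation n := (m * N)%N.
Local Notation coset := (cyclotomic_coset q).
Local Notation f := (@mulq_mod q m).
Local Notation GRh h := (GR (s * #|coset h|)%N).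
Local Notation Alg := (cyclic_algebra (GR s) n).

Let coprime_pm : coprime p m. Proof. by rewrite prime_coprime. Qed.
Let coprime_qm : coprime q m. Proof. exact: coprimeXl. Qed.
Let N_gt0 : (0 < N)%N. Proof. by rewrite expn_gt0 prime_gt0. Qed.
Let n_gt0 : (0 < n)%N. Proof. by rewrite muln_gt0 m_gt0. Qed.
Let R_gr : is_galois_ring p s (GR s). Proof. exact: GRP. Qed.

Let Rh_gr (h : 'I_m) : is_galois_ring p (s * #|coset h|) (GRh h).
Proof. by apply: GRP; rewrite muln_gt0 s_gt0 card_coset_gt0. Qed.

Variable k0 : nat.
Hypotheses (k0_gt0 : (0 < k0)%N) (m_dvd : (m %| (p ^ (s * k0)).-1)%N)
  (coset_dvd : forall h : 'I_m, (#|coset h| %| k0)%N).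

Local Notation B0 := (GR (s * k0)%N).

Let B0_gr : is_galois_ring p (s * k0) B0.
Proof. by apply: GRP; rewrite muln_gt0 s_gt0. Qed.

Variables (iota : {rmorphism GR s -> B0}) (zeta : B0).
Hypotheses (iota_inj : injective iota) (zeta_m : zeta ^+ m = 1).

Lemma zeta_mod i j : (i = j %[mod m])%N -> zeta ^+ i = zeta ^+ j.
Proof. by move=> eq_ij; rewrite -(expr_mod _ zeta_m) eq_ij expr_mod. Qed.

Let zetaQ : zeta ^+ (p ^ (s * k0)) = zeta.
Proof.
have lt0 : (0 < p ^ (s * k0))%N by rewrite expn_gt0 prime_gt0.
by case/dvdnP: m_dvd => d dE; rewrite -(prednK lt0) dE exprS
  [(d * m)%N]mulnC exprM zeta_m expr1n mulr1.
Qed.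

(** As h q^(m_h) = h modulo m, zeta^h is fixed by the power q^(m_h), so it lies in the copy of
    GR(p^2, s m_h) inside B; the same holds for the image of [iota]. *)
Lemma local_data (h : 'I_m) :
  exists (eps : {rmorphism GRh h -> B0}) (iotah : {rmorphism GR s -> GRh h}) (z : GRh h),
    [/\ injective eps, forall x, eps (iotah x) = iota x & eps z = zeta ^+ h].
Proof.
have [|eps [eps_inj eps1 eps2]] := galois_ring_embedding p_pr (Rh_gr h) B0_gr.
  by rewrite dvdn_pmul2l.
have up (t : B0) : t ^+ q = t -> t ^+ (p ^ (s * #|coset h|)) = t.
  by move=> tQ; rewrite expnM expr_expn_id.
have [|iotah iotahE] := @rmorph_factor _ _ _ eps iota eps_inj.
  move=> x; have [b [c [bQ cQ ->]]] := galois_ring_decomposition p_pr x R_gr.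
  by rewrite rmorphD rmorphMn; apply: eps2; apply: up; rewrite -rmorphXn ?bQ ?cQ.
have [|z zE] := eps1 (zeta ^+ h).
  by rewrite -exprM expnM; apply: zeta_mod; apply: mulq_exp_card_coset.
by exists eps, iotah, z.
Qed.

Variable Phi : 'I_m -> {rmorphism Alg -> cyclic_algebra B0 N}.
Hypotheses (PhiC : forall j x, Phi j (cyc_const _ _ x) = cyc_const _ _ (iota x))
  (PhiX : forall j, Phi j (cyc_gen _ _) = cyc_const _ _ (zeta ^+ j) * cyc_gen _ _).

(** The Frobenius t -> t^q of B, applied to coefficients, fixes the image of [iota] and maps zeta^h
    to zeta^(hq); it therefore carries [Phi h] to [Phi] at hq. *)
Lemma Phi_coset (h k : 'I_m) x : k \in coset h -> Phi h x = 0 -> Phi k x = 0.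
Proof.
rewrite inE => /iter_findex <-; elim: (findex _ _ _) => //= i IHi /IHi.
move: (iter i f h) => {IHi}h Phih0.
have [sigma sigmaE] := galois_ring_frobenius p_pr s B0_gr.
have sigma_iota := @frobenius_fix p s _ 1 _ _ iota sigma p_pr R_gr (dvdn_mulr k0 (dvdnn s)).
have [|sig [sigC sigX]] := cyclic_algebra_lift N_gt0 (z := cyc_gen B0 N) (cyc_const B0 N \o sigma).
  exact: cyc_gen_expn.
have <- : sig (Phi h x) = Phi (f h) x.
  apply: (@eq_cyclic_rmorph _ n (cyclic_algebra B0 N) (sig \o Phi h) (Phi (f h))) => [b|] /=.
    by rewrite !PhiC sigC /= sigma_iota // => t; rewrite muln1; apply: sigmaE.
  rewrite !PhiX rmorphM sigC sigX /= sigmaE; last first.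
    by rewrite exprAC zetaQ.
  rewrite -exprM; congr (cyc_const _ _ _ * _); apply: zeta_mod => /=.
  by rewrite modn_mod.
by rewrite Phih0 rmorph0.
Qed.

(** Composing [pi] with [eps] on coefficients gives [Phi j]. The index j is separate from h so that
    -h can be treated over the ring chosen for h. *)
Lemma component_morphism (h j : 'I_m) (eps : {rmorphism GRh h -> B0})
    (iotah : {rmorphism GR s -> GRh h}) (z : GRh h) :
  injective eps -> (forall x, eps (iotah x) = iota x) -> eps z = zeta ^+ j ->
  exists pi : {rmorphism Alg -> cyclic_algebra (GRh h) N},
    [/\ forall x, pi (cyc_const _ _ x) = cyc_const _ _ (iotah x),
        pi (cyc_gen _ _) = cyc_const _ _ z * cyc_gen _ _ &
        forall x, pi x = 0 -> Phi j x = 0].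
Proof.
move=> eps_inj epsE zE.
have z_m : z ^+ m = 1 by apply: eps_inj; rewrite rmorphXn zE rmorph1 exprAC zeta_m expr1n.
have [|pi [piC piX]] := cyclic_algebra_lift n_gt0
    (z := cyc_const (GRh h) N z * cyc_gen (GRh h) N) (cyc_const (GRh h) N \o iotah).
  by rewrite exprMn -rmorphXn exprM z_m expr1n rmorph1 mul1r
    [(m * N)%N]mulnC exprM cyc_gen_expn // expr1n.
exists pi; split=> // x pix0.
have [|epsA [epsC epsX]] := cyclic_algebra_lift N_gt0 (z := cyc_gen B0 N) (cyc_const B0 N \o eps).
  exact: cyc_gen_expn.
have <- : epsA (pi x) = Phi j x.
  apply: (@eq_cyclic_rmorph _ n (cyclic_algebra B0 N) (epsA \o pi) (Phi j)) => [b|] /=.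
    by rewrite piC epsC PhiC /= epsE.
  by rewrite piX PhiX rmorphM epsC epsX /= zE.
by rewrite pix0 rmorph0.
Qed.

Variables (J1 J2 J2' J2'' : {set 'I_m}).
Hypotheses (J1P : coset_representatives q J1 (I1 q m))
  (J2P : coset_representatives q J2 (I2 q m))
  (J2E : J2 = J2' :|: J2'') (J2D : [disjoint J2' & J2''])
  (J2''E : J2'' = [set opp_mod h | h in J2']).

Hypothesis zeta_unit : forall i, ~~ (m %| i)%N -> exists y, (zeta ^+ i - 1) * y = 1.
Hypothesis m_unit : exists y, m%:R * y = 1 :> B0.

Variable tau : {rmorphism Alg -> Alg}.
Hypotheses (tauC : forall b, tau (cyc_const _ _ b) = cyc_const _ _ b)
  (tauX : tau (cyc_gen _ _) = cyc_gen _ _ ^+ n.-1).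

(** The number of residues modulo m covered by the component of h; a pair of exchanged factors
    covers two cosets. *)
Definition local_weight (h : 'I_m) : nat :=
  if h \in I0 m then #|coset h| else if h \in J1 then #|coset h| else (2 * #|coset h|)%N.

(** The ring B is left free because a component may be one algebra or the product of two exchanged
    ones; the last clause replaces an inverse of the decomposition. *)
Definition is_component (h : 'I_m) (B : finComNzRingType) (pi : {rmorphism Alg -> B})
    (tauB : B -> B) : Prop :=
  [/\ forall x, pi (tau x) = tauB (pi x),
      forall I, ideal_set (orthogonal_ideal tauB I),
      #|B| = (p ^ (2 * s * N * local_weight h))%N,
      num_self_dual tauB = local_count p s a GR J1 h &
      forall x, pi x = 0 -> Phi h x = 0 /\ (h \in J2' -> Phi (opp_mod h) x = 0)].

Let sub1 h : h \in J1 -> h \in I1 q m.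
Proof. exact: (subsetP (transversal_sub J1P)). Qed.
Let sub2 h : h \in J2 -> h \in I2 q m.
Proof. exact: (subsetP (transversal_sub J2P)). Qed.
Let sub2' h : h \in J2' -> h \in J2.
Proof. by rewrite J2E inE => ->. Qed.

Let disjK : [/\ [disjoint I0 m & J1], [disjoint I0 m & J2'] & [disjoint J1 & J2']].
Proof. by apply: disjoint_representatives J1P J2P _ => //; rewrite J2E subsetUl. Qed.
Let disj01 : [disjoint I0 m & J1]. Proof. by case: disjK. Qed.
Let disj02 : [disjoint I0 m & J2']. Proof. by case: disjK. Qed.
Let disj12 : [disjoint J1 & J2']. Proof. by case: disjK. Qed.

Let card_comp (h : 'I_m) : #|cyclic_algebra (GRh h) N| = (p ^ (2 * s * N * #|coset h|))%N.
Proof.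
rewrite card_cyclic_algebra // (galois_ring_card p_pr (Rh_gr h)) -expnM.
by congr (_ ^ _)%N; ring.
Qed.

Lemma component_I0 h : h \in I0 m -> exists B pi tauB, @is_component h B pi tauB.
Proof.
move=> hI0; have [eps [iotah [z [eps_inj epsE zE]]]] := local_data h.
have [pi [piC piX pi0]] := component_morphism eps_inj epsE zE.
have [tauB [tauBC tauBX]] := @cyclic_involution (GRh h) N idfun N_gt0.
exists (cyclic_algebra (GRh h) N), pi, tauB;
  rewrite /is_component /local_weight /local_count hI0; split.
- apply: (involution_compat (sigma := idfun) (z := z) (z' := z)) => //.
  apply: eps_inj; rewrite rmorphM rmorph1 zE -exprD -(expr0 zeta); apply: zeta_mod.
  by move: hI0; rewrite I0_opp => /eqP E; apply/eqP; rewrite mod0n opp_modE E.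
- by move=> I; apply: orthogonal_ideal_rmorph.
- exact: card_comp.
- rewrite -(num_self_dual_codes N_gt0 tauBC tauBX (f := id)) //.
  by rewrite (I0_coset coprime_qm hI0) cards1 muln1.
- move=> x /pi0; split=> // /sub2'/sub2.
  by rewrite in_setC in_setU hI0.
Qed.

Lemma component_J1 h : h \in J1 -> exists B pi tauB, @is_component h B pi tauB.
Proof.
move=> hJ1; have [hI0 cardE iterE] := mem_I1 coprime_qm (sub1 hJ1).
have [eps [iotah [z [eps_inj epsE zE]]]] := local_data h.
have [pi [piC piX pi0]] := component_morphism eps_inj epsE zE.
set k := #|coset h|./2 in cardE iterE.
(* The conjugation exponent p^(s m_h / 2) is q^k, the power of q that maps h to -h. *)
have halfE : (s * #|coset h|)./2 = (s * k)%N by rewrite -cardE -doubleMr doubleK.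
have [sigma sigmaE] := galois_ring_frobenius p_pr (s * k) (Rh_gr h).
have [tauB [tauBC tauBX]] := cyclic_involution sigma N_gt0.
exists (cyclic_algebra (GRh h) N), pi, tauB;
  rewrite /is_component /local_weight /local_count (negPf hI0) hJ1; split.
- apply: (involution_compat (sigma := sigma) (z := z) (z' := z)) => //.
    exact: frobenius_fix p_pr R_gr (dvdn_mulr _ (dvdnn s)) sigmaE.
  apply: (eps_inj); rewrite sigmaE; last first.
    apply: eps_inj; rewrite rmorphXn zE -exprM expnM; apply: zeta_mod.
    exact: mulq_exp_card_coset.
  rewrite rmorphM rmorphXn rmorph1 zE -exprM -exprD -(expr0 zeta) expnM; apply: zeta_mod.
  by rewrite -modnDmr -iter_mulq_mod iterE mod0n; apply/eqP; rewrite opp_modE.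
- by move=> I; apply: orthogonal_ideal_rmorph.
- exact: card_comp.
- rewrite -(num_self_dual_codes N_gt0 tauBC tauBX
  (f := @galois_conj p (s * #|coset h|) (GRh h))) //.
  by apply: galois_conjE => // t tQ; rewrite halfE sigmaE.
- move=> x /pi0; split=> // hJ2'.
  by rewrite (disjointFr disj12 hJ1) in hJ2'.
Qed.

Lemma component_J2 h : h \in J2' -> exists B pi tauB, @is_component h B pi tauB.
Proof.
move=> hJ2; have [eps [iotah [z [eps_inj epsE zE]]]] := local_data h.
have [pi [piC piX pi0]] := component_morphism eps_inj epsE zE.
(* z^(m-1) is the inverse of z, so the factor of -h is realised over the same ring as that of h. *)
have z'E : eps (z ^+ m.-1) = zeta ^+ opp_mod h.
  rewrite rmorphXn zE -exprM; apply: zeta_mod; apply/eqP.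
  rewrite -(eqn_modDl h) -mulnS prednK // modnMl eq_sym.
  by rewrite opp_modE.
have z_m : z ^+ m = 1 by apply: eps_inj; rewrite rmorphXn zE rmorph1 exprAC zeta_m expr1n.
have [pi' [pi'C pi'X pi'0]] := component_morphism eps_inj epsE z'E.
have [tauB [tauBC tauBX]] := @cyclic_involution (GRh h) N idfun N_gt0.
pose A := cyclic_algebra (GRh h) N.
pose pp x : A * A := (pi x, pi' x).
have ppB : zmod_morphism pp by move=> x y; rewrite /pp !rmorphB.
have ppM : monoid_morphism pp by split=> [|x y]; rewrite /pp ?rmorph1 ?rmorphM.
pose ppBI := GRing.isZmodMorphism.Build _ _ pp ppB.
pose ppMI := GRing.isMonoidMorphism.Build _ _ pp ppM.
pose P : {rmorphism Alg -> (A * A)%type} := HB.pack pp ppBI ppMI.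
have hI0 := disjointFl disj02 hJ2; have hJ1 := disjointFl disj12 hJ2.
exists (A * A)%type, P, (swap_morphism tauB).
rewrite /is_component /local_weight /local_count hI0 hJ1; split.
- move=> x; congr (_, _).
    apply: (involution_compat (sigma := idfun) (z := z) (z' := z ^+ m.-1)) => //.
    by rewrite -exprS prednK.
  apply: (involution_compat (sigma := idfun) (z := z ^+ m.-1) (z' := z)) => //.
  by rewrite -exprSr prednK.
- exact: orthogonal_swap_ideal.
- by rewrite card_prod !card_comp -expnD; congr (_ ^ _)%N; ring.
- rewrite num_self_dual_swap ?num_cyclicE //.
  have [k [rho rhoP]] := galois_ring_residue p_pr (Rh_gr h).
  by move=> I; apply: orthogonal_idealK rhoP _ _.
- by move=> x [/pi0 ? /pi'0].
Qed.

(** Negation preserves coset sizes, so doubling the cosets of J2' accounts for all of [I2]. *)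
Lemma sum_local_weight : (\sum_(h in I0 m :|: (J1 :|: J2')) local_weight h = m)%N.
Proof.
rewrite /local_weight (big_three_sets addn) //.
rewrite (eq_bigr (fun=> 1%N)) => [|h hI0]; last by rewrite (I0_coset coprime_qm hI0) cards1.
rewrite sum1_card (sum_card_coset J1P) -big_distrr /=.
have -> : (2 * \sum_(h in J2') #|coset h| = #|I2 q m|)%N.
  rewrite -(sum_card_coset J2P) J2E.
  transitivity (\sum_(h in J2') #|coset h| + \sum_(h in J2'') #|coset h|)%N; last first.
    by rewrite -bigU //; apply: eq_bigl => h; rewrite !inE.
  rewrite mul2n -addnn; congr addn; rewrite J2''E big_imset /=.
    by apply: eq_bigr => h _; rewrite card_coset_opp.
  by move=> h h' _ _; apply: can_inj (@opp_modK m) _ _.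
have I01 : I0 m :&: I1 q m = set0 by apply: disjoint_setI0; apply: disjoint_I0_I1.
by rewrite addnA -cardsUI I01 cards0 addn0 /I2 cardsC card_ord.
Qed.

(** Each j lies in [I0] or in the coset of an element of J1, J2' or J2''; the last case is reached
    through the opposite of an element of J2'. *)
Lemma Phi_eq0 x : (forall h, h \in I0 m :|: (J1 :|: J2') ->
    Phi h x = 0 /\ (h \in J2' -> Phi (opp_mod h) x = 0)) -> x = 0.
Proof.
move=> Phi0; have coNm : coprime m N by rewrite coprime_sym coprimeXl.
apply: (fourier_inj m_gt0 N_gt0 coNm iota_inj zeta_m zeta_unit m_unit PhiC PhiX) => j.
have [jI0|jI0] := boolP (j \in I0 m); first by apply: (Phi0 j _).1; rewrite in_setU jI0.
have [jI1|jI1] := boolP (j \in I1 q m).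
  have [h hJ1 /Phi_coset] := coset_representative J1P jI1; apply.
  by apply: (Phi0 h _).1; rewrite !in_setU hJ1 orbT.
have jI2 : j \in I2 q m by rewrite in_setC in_setU negb_or jI0.
have [h hJ2 /Phi_coset] := coset_representative J2P jI2; apply.
move: hJ2; rewrite J2E in_setU => /orP[hJ2'|].
  by apply: (Phi0 h _).1; rewrite !in_setU hJ2' !orbT.
rewrite J2''E => /imsetP[h' h'J2' ->].
by apply: (Phi0 h' _).2; rewrite ?in_setU ?h'J2' ?orbT.
Qed.

Lemma num_euclidean_local :
  num_euclidean (GR s) n = (\prod_(h in I0 m :|: (J1 :|: J2')) local_count p s a GR J1 h)%N.
Proof.
set K := I0 m :|: (J1 :|: J2').
have comp (h : {h in K}) : exists B pi tauB, @is_component (val h) B pi tauB.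
  have := valP h; rewrite !in_setU => /or3P[]; [exact: component_I0 | exact: component_J1 |].
  exact: component_J2.
have [B compB] := fin_all_exists comp; have [pi comppi] := fin_all_exists compB.
have [tauB compP] := fin_all_exists comppi.
have pi_inj x : (forall h, pi h x = 0) -> x = 0.
  move=> pix0; apply: Phi_eq0 => h hK.
  by have [_ _ _ _ /(_ x)] := compP (Sub h hK); apply; apply: pix0.
have pi_surj : forall y : (forall h, B h), exists x, forall h, pi h x = y h.
  apply: joint_surj pi_inj _.
  (* Both cardinalities equal p^(2sNm), as the weights add up to m and |GR(p^2, s)| = p^(2s). *)
  rewrite (eq_bigr (fun h => p ^ (2 * s * N * local_weight (val h)))%N) => [|h _]; last first.
    by have [_ _ -> _ _] := compP h.
  rewrite -expn_sum -big_distrr /= -(big_sub [in K] local_weight) sum_local_weight.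
  rewrite card_cyclic_algebra // (galois_ring_card p_pr R_gr) -expnM.
  by rewrite leq_eqVlt; apply/orP; left; apply/eqP; congr (_ ^ _)%N; ring.
rewrite (big_sub [in K]).
rewrite [LHS](num_self_dual_codes n_gt0 (sigma := idfun) tauC tauX (f := id)) //.
rewrite (num_self_dual_prod (tauB := tauB) pi_inj pi_surj).
- by apply: eq_bigr => h _; have [_ _ _ -> _] := compP h.
- by move=> h x; have [-> _ _ _ _] := compP h.
- by move=> h I; have [_ -> _ _ _] := compP h.
Qed.

End Assembly.

Lemma num_euclidean_prod_local (p s m a : nat) (GR : nat -> finComNzRingType)
    (J1 J2 J2' J2'' : {set 'I_m}) :
  prime p -> (0 < s)%N -> (0 < m)%N -> ~~ (p %| m)%N ->
  (forall r : nat, (0 < r)%N -> is_galois_ring p r (GR r)) ->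
  coset_representatives (p ^ s) J1 (I1 (p ^ s) m) ->
  coset_representatives (p ^ s) J2 (I2 (p ^ s) m) ->
  J2 = J2' :|: J2'' -> [disjoint J2' & J2''] -> J2'' = [set opp_mod h | h in J2'] ->
  num_euclidean (GR s) (m * p ^ a) =
    (\prod_(h in I0 m :|: (J1 :|: J2')) local_count p s a GR J1 h)%N.
Proof.
move=> p_pr s_gt0 m_gt0 p_m GRP J1P J2P J2E J2D J2''E.
have [k0 [k0_gt0 m_dvd coset_dvd]] := exists_common_degree s p_pr p_m m_gt0.
pose B := GR (s * k0)%N.
have BP : is_galois_ring p (s * k0)%N B by apply: GRP; rewrite muln_gt0 s_gt0.
have [|iota [iota_inj _ _]] := galois_ring_embedding p_pr (GRP s s_gt0) BP.
  exact: dvdn_mulr.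
have [zeta [zeta_m _ zeta_unit m_unit]] := galois_ring_root p_pr BP m_dvd.
have N_gt0 : (0 < p ^ a)%N by rewrite expn_gt0 prime_gt0.
have n_gt0 : (0 < m * p ^ a)%N by rewrite muln_gt0 m_gt0.
have PhiP (j : 'I_m) : exists phi : {rmorphism cyclic_algebra (GR s) (m * p ^ a) ->
    cyclic_algebra B (p ^ a)},
    (forall x, phi (cyc_const _ _ x) = cyc_const _ _ (iota x)) /\
    phi (cyc_gen _ _) = cyc_const _ _ (zeta ^+ j) * cyc_gen _ _.
  apply: (cyclic_algebra_lift n_gt0 (cyc_const B (p ^ a) \o iota)).
  rewrite exprMn -rmorphXn -exprM mulnCA exprM zeta_m expr1n rmorph1 mul1r.
  by rewrite [(m * _)%N]mulnC exprM cyc_gen_expn // expr1n.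
have [Phi PhiE] := fin_all_exists PhiP.
have [tau [tauC tauX]] := @cyclic_involution (GR s) _ idfun n_gt0.
exact: (@num_euclidean_local p s m a GR p_pr s_gt0 m_gt0 p_m GRP k0 k0_gt0 m_dvd
  coset_dvd iota zeta iota_inj zeta_m Phi (fun j => (PhiE j).1) (fun j => (PhiE j).2)
  J1 J2 J2' J2'' J1P J2P J2E J2D J2''E zeta_unit m_unit tau tauC tauX).
Qed.

Local Close Scope ring_scope.

Theorem corollary4p7 (p s m a : nat) (GR : nat -> finComNzRingType)
    (J1 J2 J2' J2'' : {set 'I_m}) :
  prime p -> (1 <= s)%N -> (1 <= m)%N -> ~~ (p %| m)%N ->
  (forall r : nat, (0 < r)%N -> is_galois_ring p r (GR r)) ->
  coset_representatives (p ^ s) J1 (I1 (p ^ s) m) ->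
  coset_representatives (p ^ s) J2 (I2 (p ^ s) m) ->
  (forall h : 'I_m, (h \in J2) = (opp_mod h \in J2)) ->
  J2 = J2' :|: J2'' -> [disjoint J2' & J2''] ->
  J2'' = [set opp_mod h | h in J2'] ->
  num_euclidean (GR s) (m * p ^ a) =
    (num_euclidean (GR s) (p ^ a) ^ (if odd m then 1 else 2) *
     (\prod_(h in J1)
        let r := s * #|cyclotomic_coset (p ^ s) h| in
        num_hermitian (GR r) (p ^ a) p r) *
     (\prod_(k in J2')
        num_cyclic (GR (s * #|cyclotomic_coset (p ^ s) k|)) (p ^ a)))%N.
Proof.
move=> p_pr s_gt0 m_gt0 p_m GRP J1P J2P _ J2E J2D J2''E.
rewrite (num_euclidean_prod_local a p_pr s_gt0 m_gt0 p_m GRP J1P J2P J2E J2D J2''E).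
have co_qm : coprime (p ^ s) m by rewrite coprimeXl ?prime_coprime.
have J2'J2 : J2' \subset J2 by rewrite J2E subsetUl.
have [dI0J1 dI0J2 dJ1J2] := disjoint_representatives co_qm J1P J2P J2'J2.
(* The factor is constant on [I0], which produces a power with exponent |I0|, equal to 1 or 2 by the
   parity of m. *)
rewrite /local_count (big_three_sets muln) //.
by rewrite /= prod_nat_const card_I0 // mulnA.
Qed.
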